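(* The Hecke permutation $w(T)$ of an increasing tableau $T$ of type A is invariant under jeu de taquin slides; that is, if $T'$ is obtained from $T$ by a forward or reverse slide (for $\mathbb{N}^2$), then $w(T')=w(T)$.
   Context: **Type A.** Let $\Lambda=\mathbb{N}^2$ ($\mathbb{N}=\{1,2,3,\dots\}$), whose elements $[r,c]$ are boxes in row $r$ (rows numbered top to bottom) and column $c$ (columns numbered left to right), with partial order $[r_1,c_1]\le[r_2,c_2]$ iff $r_1\le r_2$ and $c_1\le c_2$. A straight shape is a finite lower order ideal of $\mathbb{N}^2$; a skew shape is $\nu/\lambda:=\nu\setminus\lambda$ with $\lambda\subset\nu$ straight shapes. An increasing tableau of type A is a map $T:\nu/\lambda\to\mathbb{Z}$ on a skew shape with $T(\alpha)<T(\beta)$ whenever $\alpha<\beta$. **Slides.** Two boxes are neighbors if one covers the other. For a tableau $Y$ with values in a set $S$ and $s,s'\in S$, $\mathrm{swap}_{s,s'}(Y)$ is the tableau of the same shape sending $\alpha$ to $s'$ if $Y(\alpha)=s$ and $Y(\beta)=s'$ for some neighbor $\beta$ of $\alpha$; to $s$ if $Y(\alpha)=s'$ and $Y(\beta)=s$ for some neighbor $\beta$ of $\alpha$; and to $Y(\alpha)$ otherwise. If $T$ is increasing of shape $\nu/\lambda$ with values in $[a,b]$ and $C$ is a set of maximal boxes of $\lambda$, the forward slide $\mathrm{jdt}_C(T)$ is obtained by adding the boxes of $C$ filled with $\bullet$, applying $\mathrm{swap}_{a,\bullet},\mathrm{swap}_{a+1,\bullet},\dots,\mathrm{swap}_{b,\bullet}$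 in this order, and deleting all boxes containing $\bullet$. If $\widehat C$ is a set of minimal boxes of $\mathbb{N}^2\setminus\nu$, the reverse slide starting from $\widehat C$ is obtained by adding the boxes of $\widehat C$ filled with $\bullet$, applying $\mathrm{swap}_{b,\bullet},\mathrm{swap}_{b-1,\bullet},\dots,\mathrm{swap}_{a,\bullet}$ in this order, and deleting all boxes containing $\bullet$. The results are increasing tableaux. **Hecke permutation.** Let $\Sigma$ be the group of bijections $w:\mathbb{Z}\to\mathbb{Z}$ with $w(x)=x$ for all but finitely many $x$, viewed as a Coxeter group generated by the simple transpositions $s_i=(i,i+1)$, $i\in\mathbb{Z}$, with length function $\ell$. The Hecke product on $\Sigma$ is the associative monoid product determined by $u\cdot s_i=us_i$ if $\ell(us_i)>\ell(u)$ and $u\cdot s_i=u$ otherwise, and $u\cdot v=u\cdot s_{i_1}\cdot s_{i_2}\cdots s_{i_\ell}$ (multiplied left to right) for any reduced expression $v=s_{i_1}\cdots s_{i_\ell}$. For a word $\mathbf{a}=(a_1,\dots,a_k)$ of integers let $w(\mathbf{a})=s_{a_1}\cdot s_{a_2}\cdot\ldots\cdot s_{a_k}$ (Hecke product). A reading word of an increasing tableau $T$ is any word listing the entries of the boxes of $T$ in an order in which each box $[r,c]$ appears before all other boxes $[r',c']$ of $T$ with $r'\le r$ and $c'\ge c$ (for example the row word, reading rows left to right starting with the bottom row). The Hecke permutation is $w(T)=w(\mathbf{a})$ for any reading word $\mathbf{a}$ of $T$; it is independent of the choice of reading word. *)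

(* Defs.v *)
From HB Require Import structures.
From mathcomp Require Import all_boot all_order all_algebra.
From mathcomp Require Import finmap boolp.
From mathcomp Require Import zify.

Set Implicit Arguments.
Unset Strict Implicit.
Unset Printing Implicit Defensive.

Import Order.TTheory GRing.Theory Num.Theory.

Local Open Scope fset_scope.

(* The box in row r and column c, numbered from 1 as usual, is the pair
   (r.-1, c.-1): ranging over all of [nat] with the componentwise order [*p],
   these pairs form the poset of pairs of positive integers.                  *)
Definition box : Type := (nat *p nat)%type.

Lemma box_leE (x y : box) : (x <= y)%O = (x.1 <= y.1) && (x.2 <= y.2).
Proof. by []. Qed.

Lemma box_ltE (x y : box) :
  (x < y)%O = [&& x.1 <= y.1, x.2 <= y.2 & x.1 + x.2 < y.1 + y.2].
Proof.
by rewrite lt_neqAle box_leE; case: x y => [a b] [c d]; rewrite -pair_eqE /=; lia.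
Qed.

Definition straight_shape (nu : {fset box}) : Prop :=
  forall x y : box, (x <= y)%O -> y \in nu -> x \in nu.

(* The pair (lambda, nu) is part of the data: the same set of boxes may be
   written as a skew shape in several ways, and slides depend on the choice.  *)
Definition increasing_tableau (lambda nu : {fset box}) (T : {fmap box -> int})
    : Prop :=
  [/\ straight_shape lambda, straight_shape nu, lambda `<=` nu,
      domf T = nu `\` lambda
    & forall x y : domf T, (val x < val y)%O -> (T x < T y)%R].

Definition covers (x y : box) : bool :=
  `[< (x < y)%O /\ forall z : box, ~ (x < z < y)%O >].

Lemma coversE (x y : box) :
  covers x y = (y == (x.1.+1, x.2)) || (y == (x.1, x.2.+1)).
Proof.
apply/asboolP/idP; case: x y => [a b] [c d]; rewrite box_ltE -!pair_eqE /=.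
  move=> [lt_xy no]; have := no (a.+1, b); have := no (a, b.+1).
  by rewrite !box_ltE /=; lia.
by move=> h; split=> [|[e f]]; rewrite ?box_ltE /=; lia.
Qed.

Definition neighbors (x y : box) : bool := covers x y || covers y x.

Definition swap (S : eqType) (s s' : S) (Y : {fmap box -> S})
    : {fmap box -> S} :=
  [fmap x : domf Y =>
     if (Y x == s) && [exists y : domf Y, neighbors (val x) (val y) && (Y y == s')]
     then s'
     else if (Y x == s') &&
             [exists y : domf Y, neighbors (val x) (val y) && (Y y == s)]
     then s
     else Y x].

(* Tableaux with bullets take values in [option int]; [None] is the bullet.   *)
Definition add_bullets (T : {fmap box -> int}) (C : {fset box})
    : {fmap box -> option int} :=
  [fmap x : domf T `|` C => T.[? val x]%fmap].

Definition del_bullets (Y : {fmap box -> option int}) : {fmap box -> int} :=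
  reducef Y.

Definition int_range (a b : int) : seq int :=
  if (a <= b)%R then [seq (a + i%:Z)%R | i <- iota 0 `|b - a|%N.+1] else [::].

Definition swap_bullets (Y : {fmap box -> option int}) (s : seq int) :=
  foldl (fun Z i => swap (Some i) None Z) Y s.

Definition forward_jdt (a b : int) (C : {fset box}) (T : {fmap box -> int}) :=
  del_bullets (swap_bullets (add_bullets T C) (int_range a b)).

Definition reverse_jdt (a b : int) (C : {fset box}) (T : {fmap box -> int}) :=
  del_bullets (swap_bullets (add_bullets T C) (rev (int_range a b))).

Definition values_in (a b : int) (T : {fmap box -> int}) : Prop :=
  forall x : domf T, (a <= T x <= b)%R.

Definition maximal_box (lambda : {fset box}) (x : box) : Prop :=
  x \in lambda /\ forall y, y \in lambda -> ~ (x < y)%O.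

Definition minimal_outer_box (nu : {fset box}) (x : box) : Prop :=
  x \notin nu /\ forall y, y \notin nu -> ~ (y < x)%O.

Definition forward_slide (lambda : {fset box}) (T T' : {fmap box -> int})
    : Prop :=
  exists (a b : int) (C : {fset box}),
    [/\ values_in a b T, forall x, x \in C -> maximal_box lambda x
      & T' = forward_jdt a b C T].

Definition reverse_slide (nu : {fset box}) (T T' : {fmap box -> int}) : Prop :=
  exists (a b : int) (C : {fset box}),
    [/\ values_in a b T, forall x, x \in C -> minimal_outer_box nu x
      & T' = reverse_jdt a b C T].

(* For a function equal to the identity outside a finite set, injectivity is
   equivalent to bijectivity.                                                 *)
Record permZ : Type := PermZ {
  permZ_fun :> {fsfun int -> int};
  permZ_inj : fsinjectiveb permZ_fun }.

HB.instance Definition _ := [isSub for permZ_fun].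
HB.instance Definition _ := [Choice of permZ by <:].

Lemma permZP (u v : permZ) : u =1 v <-> u = v.
Proof.
split=> [e|->//]; apply: val_inj; exact/fsfunP.
Qed.

Lemma permZI (u : permZ) : injective u.
Proof. exact/fsinjectiveP/permZ_inj. Qed.

Fact permZ_one_subproof : fsinjectiveb ([fsfun] : {fsfun int -> int}).
Proof. by apply/fsinjectiveP => x y; rewrite !fsfun0E. Qed.

Definition permZ_one := PermZ permZ_one_subproof.

Fact permZ_mul_subproof (u v : permZ) :
  fsinjectiveb (fsfun_comp u v : {fsfun int -> int}).
Proof. apply/fsinjectiveP; apply: fscomp_inj; exact: permZI. Qed.

(* [u * v] is the composite applying [v] first. *)
Definition permZ_mul u v := PermZ (permZ_mul_subproof u v).

Lemma permZ_mulE u v x : permZ_mul u v x = u (v x).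
Proof. by rewrite /= fscompE. Qed.

Definition permZ_inv_fun (u : permZ) : {fsfun int -> int} :=
  [fsfun x in finsupp u =>
     oapp val x [pick y : finsupp u | u (val y) == x]].

Lemma permZ_inv_funK (u : permZ) x : u (permZ_inv_fun u x) = x.
Proof.
rewrite /permZ_inv_fun fsfunE; case: ifPn => [xu|]; last exact: fsfun_dflt.
case: pickP => [y /eqP //|no] /=.
have /imfset_eq_fsinjectiveP e := permZ_inj u.
move: xu; rewrite -{1}e => /imfsetP [y /= yu xE].
by have := no [` yu]; rewrite /= xE eqxx.
Qed.

Fact permZ_inv_subproof (u : permZ) : fsinjectiveb (permZ_inv_fun u).
Proof.
by apply/fsinjectiveP; apply: (can_inj (g := u)) => x; exact: permZ_inv_funK.
Qed.

Definition permZ_inv u := PermZ (permZ_inv_subproof u).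

Lemma permZ_mulA : associative permZ_mul.
Proof. by move=> u v w; apply/permZP => x; rewrite !permZ_mulE. Qed.

Lemma permZ_mul1 : left_id permZ_one permZ_mul.
Proof. by move=> u; apply/permZP => x; rewrite permZ_mulE fsfun0E. Qed.

Lemma permZ_1mul : right_id permZ_one permZ_mul.
Proof. by move=> u; apply/permZP => x; rewrite permZ_mulE fsfun0E. Qed.

Lemma permZ_mulV : right_inverse permZ_one permZ_inv permZ_mul.
Proof.
by move=> u; apply/permZP => x; rewrite permZ_mulE permZ_inv_funK fsfun0E.
Qed.

Lemma permZ_Vmul : left_inverse permZ_one permZ_inv permZ_mul.
Proof.
move=> u; apply/permZP => x; apply: (@permZI u).
by rewrite permZ_mulE permZ_inv_funK fsfun0E.
Qed.

HB.instance Definition _ := isGroup.Build permZ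
  permZ_mulA permZ_mul1 permZ_1mul permZ_Vmul permZ_mulV.

Lemma permZM (u v : permZ) x : (u * v)%g x = u (v x).
Proof. exact: permZ_mulE. Qed.

Lemma permZ1 x : (1%g : permZ) x = x.
Proof. exact: fsfun0E. Qed.

Definition simple_fun (i : int) : {fsfun int -> int} :=
  [fsfun [fsfun] with i |-> (i + 1)%R, (i + 1)%R |-> i].

Lemma simple_funE i x : simple_fun i x =
  if x == i then (i + 1)%R else if x == (i + 1)%R then i else x.
Proof. by rewrite !fsfun_withE fsfun0E. Qed.

Fact simple_subproof i : fsinjectiveb (simple_fun i).
Proof.
apply/fsinjectiveP => x y; rewrite !simple_funE.
by do 4?case: eqP; lia.
Qed.

Definition simple (i : int) : permZ := PermZ (simple_subproof i).

Lemma simpleE i x : simple i x =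
  if x == i then (i + 1)%R else if x == (i + 1)%R then i else x.
Proof. exact: simple_funE. Qed.

Lemma simple_gen (w : permZ) :
  exists a : seq int, (\prod_(i <- a) simple i)%g = w.
Proof.
have [m [n supp]] : exists m n, forall x,
    ~~ (m <= x < m + Posz n)%R -> w x = x.
  have [N hN] : exists N : nat, forall x, x \in finsupp w -> `|x|%N < N.
    exists (\max_(x <- enum_fset (finsupp w)) `|x|%N).+1 => x xw.
    by rewrite ltnS; apply: leq_bigmax_seq.
  exists (- Posz N)%R, (N + N)%N => x hx; apply: fsfun_dflt.
  by apply/negP => /hN; move: hx; lia.
elim: n w supp => [|n IHn] w supp.
  exists [::]; rewrite big_nil; apply/permZP => x.
  by rewrite permZ1 supp //; lia.
pose M := (m + Posz n)%R.
have [j [k [jk wj]]] : exists j k, (j + Posz k = M)%R /\ w j = M.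
  have wwM : w (w^-1%g M) = M by rewrite -permZM mulgV permZ1.
  have [hlt|hge] := boolP (w^-1%g M <= M)%R.
    by exists (w^-1%g M), `|M - w^-1%g M|%N; split => //; lia.
  have wMfix : w (w^-1%g M) = w^-1%g M by apply: supp; rewrite /M in hge *; lia.
  by move: hge; rewrite -wMfix wwM lexx.
elim: k j w supp jk wj => [|k IHk] j w supp jk wj.
  have {}jk : j = M by lia.
  apply: IHn => x hx; have [->|xM] := eqVneq x M; first by rewrite -{1}jk.
  by apply: supp; rewrite /M in xM; lia.
have jm : (m <= j)%R.
  rewrite leNgt; apply/negP => jm.
  by have : w j = j; [apply: supp; lia | rewrite wj; lia].
have [||| a aE] := IHk (j + 1)%R (w * simple j)%g.
- move=> x hx; rewrite permZM simpleE; rewrite /M in jk.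
  by do 2 (case: eqP => [?|_]; first by lia); apply: supp.
- by lia.
- by rewrite permZM simpleE; case: eqP => [|_]; [lia | rewrite eqxx].
exists (rcons a j); rewrite -cats1 big_cat /= big_seq1 aE -mulgA.
suff -> : (simple j * simple j)%g = 1%g by rewrite mulg1.
apply/permZP => x; rewrite permZM permZ1 !simpleE.
by do ![case: eqP]; lia.
Qed.

Definition has_expression (w : permZ) (n : nat) : bool :=
  `[< exists2 a : seq int, size a = n & (\prod_(i <- a) simple i)%g = w >].

Fact has_expressionP w : exists n, has_expression w n.
Proof. by have [a aE] := simple_gen w; exists (size a); apply/asboolP; exists a. Qed.

Definition length (w : permZ) : nat := ex_minn (has_expressionP w).

Definition reduced_expression (w : permZ) (a : seq int) : bool :=
  ((\prod_(i <- a) simple i)%g == w) && (size a == length w).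

Fact reduced_expressionP w : exists a, reduced_expression w a.
Proof.
rewrite /reduced_expression /length; case: ex_minnP => n /asboolP[a <- aE] _.
by exists a; rewrite aE !eqxx.
Qed.

Definition hecke_simple (u : permZ) (i : int) : permZ :=
  if length u < length (u * simple i)%g then (u * simple i)%g else u.

(* The value does not depend on the reduced expression chosen for [v]. *)
Definition hecke (u v : permZ) : permZ :=
  foldl hecke_simple u (xchoose (reduced_expressionP v)).

Definition hecke_word (a : seq int) : permZ :=
  foldl hecke 1%g [seq simple i | i <- a].

Definition reading_order (T : {fmap box -> int}) (s : seq box) : Prop :=
  [/\ uniq s, s =i domf T
    & forall x y : box, x \in s -> y \in s -> x != y ->
        y.1 <= x.1 -> x.2 <= y.2 -> index x s < index y s].

Definition reading_word (T : {fmap box -> int}) (a : seq int) : Prop :=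
  exists2 s : seq box, reading_order T s
    & [seq T.[? x]%fmap | x <- s] = [seq Some i | i <- a].

Definition row_before : rel box :=
  fun x y => (y.1 < x.1) || (x.1 == y.1) && (x.2 <= y.2).

Definition row_word (T : {fmap box -> int}) : seq int :=
  pmap (fun x => T.[? x]%fmap) (sort row_before (enum_fset (domf T))).

Lemma row_word_reading T : reading_word T (row_word T).
Proof.
have total : total row_before by move=> x y; rewrite /row_before; lia.
have trans : transitive row_before by move=> x y z; rewrite /row_before; lia.
exists (sort row_before (enum_fset (domf T))).
  split=> [|x|x y xs ys xy h1 h2]; first by rewrite sort_uniq fset_uniq.
    by rewrite mem_sort.
  rewrite ltnNge; apply/negP => ji.
  have refl : reflexive row_before by move=> z; rewrite /row_before; lia.
  have := sorted_leq_index trans refl (sort_sorted total _) _ _ ys xs ji.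
  rewrite /row_before => yx.
  by case: x y xy h1 h2 yx {xs ys ji} => [b c] [d e]; rewrite -pair_eqE /=; lia.
rewrite /row_word; set s := sort _ _.
have : {subset s <= domf T} by move=> x; rewrite mem_sort.
elim: s => //= x s IHs sT; rewrite in_fnd /=; first by apply: sT; rewrite mem_head.
by move=> xT; rewrite IHs // => y ys; apply: sT; rewrite in_cons ys orbT.
Qed.

(* Main.v *)
(** Read a tableau one diagonal [c - r = t] at a time: the entries on a diagonal
    commute pairwise.  Halfway through a slide the bullets lie strictly between
    [i] and [i + 1], and there is at most one of them on each diagonal.  Give
    every bullet that has a neighbor [j] the value [j] and delete the other
    bullets; for [j = i + 1] this gives the same filling before and after
    [swap_{j,bullet}], since a ribbon of [j]'s and bullets is filled with [j]'s
    either way.  It remains to see that filling with [i] and filling with [i + 1]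
    produce the same Hecke permutation.  The filled diagonals may contain
    noncommuting entries, so the order in which they are read matters: with the
    [i]'s read last on their diagonals for the first filling and the [i + 1]'s
    read first for the second one, a left-to-right pass over the diagonals
    transforms one word into the other, by idempotence, commutations, and a
    braid move at each diagonal containing both [i] and [i + 1].  For a given
    filling, reading the filled value first or last makes no difference. *)
Require Import Defs.
From mathcomp Require Import all_boot all_order all_algebra.
From mathcomp Require Import finmap boolp zify.

Set Implicit Arguments.
Unset Strict Implicit.
Unset Printing Implicit Defensive.

Import Order.TTheory GRing.Theory Num.Theory.

Local Open Scope fset_scope.

(** * The Hecke action on permutations *)

(** The starting permutation is arbitrary, so that equalities of actions can be used in the middle
    of longer words. *)
Definition act (u : permZ) (a : seq int) : permZ := foldl hecke_simple u a.

Lemma act_cat u a b : act u (a ++ b) = act (act u a) b.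
Proof. exact: foldl_cat. Qed.

(* Follow the images of [x] and [y] through the word from the right: the letter
   that reverses their order is the one to delete. *)
Lemma prod_exchange (a : seq int) (x y : int) : (x < y)%R ->
  ((\prod_(i <- a) simple i)%g y < (\prod_(i <- a) simple i)%g x)%R ->
  exists2 a', (size a').+1 = size a &
    forall z, (\prod_(i <- a') simple i)%g z =
      (\prod_(i <- a) simple i)%g (if z == x then y else if z == y then x else z).
Proof.
move=> xy; elim: a => [|k a IHa]; first by rewrite big_nil !permZ1 => yx; exfalso; lia.
rewrite big_cons !permZM => inv.
set v := (\prod_(j <- a) simple j)%g in IHa inv *.
have [vyx|] := boolP (v y < v x)%R.
  have [a' sa' a'E] := IHa vyx.
  exists (k :: a'); first by rewrite /= sa'.
  by move=> z; rewrite !big_cons !permZM a'E.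
rewrite -leNgt => vxy.
exists a => // z; rewrite -/v permZM.
have vx : v x = k.
  by move: inv; rewrite !simpleE; repeat case: eqP => ?; lia.
have vy : v y = (k + 1)%R.
  have : v x != v y by rewrite (inj_eq (@permZI v)); lia.
  by move: inv; rewrite !simpleE; repeat case: eqP => ?; lia.
have [->|zx] := eqVneq z x; first by rewrite vy simpleE; repeat case: eqP => ?; lia.
have [->|zy] := eqVneq z y; first by rewrite vx simpleE eqxx.
have : v z != v x by rewrite (inj_eq (@permZI v)).
have : v z != v y by rewrite (inj_eq (@permZI v)).
by rewrite simpleE vx vy => /negPf-> /negPf->.
Qed.

Lemma simpleK i : (simple i * simple i)%g = 1%g.
Proof.
apply/permZP => x; rewrite permZM permZ1 (simpleE i x).
by repeat case: eqP => ?; rewrite simpleE; repeat case: eqP => ?; lia.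
Qed.

Lemma length_attained (w : permZ) :
  exists2 a : seq int, size a = length w & (\prod_(i <- a) simple i)%g = w.
Proof. by rewrite /length; case: ex_minnP => n /asboolP. Qed.

Lemma length_le (a : seq int) : length (\prod_(i <- a) simple i)%g <= size a.
Proof.
by rewrite /length; case: ex_minnP => n _; apply; apply/asboolP; exists a.
Qed.

(** Exchange in a shortest word for [u] gives a word for [u * simple i] with one letter fewer. *)
Lemma length_descent (u : permZ) i : (u (i + 1) < u i)%R ->
  length (u * simple i)%g < length u.
Proof.
have [a <- <-] := length_attained u => inv.
have [|a' <- a'E] := prod_exchange _ inv; first by lia.
rewrite ltnS; suff -> : ((\prod_(j <- a) simple j) * simple i)%g =
  (\prod_(j <- a') simple j)%g by exact: length_le.
by apply/permZP => z; rewrite a'E permZM simpleE.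
Qed.

(** Trades lengths for values. At an ascent of [u], the product [u * simple i] has a descent at [i],
    and multiplying it by [simple i] gives back [u], so [u] is the shorter one. *)
Lemma hecke_simpleE (u : permZ) i :
  hecke_simple u i = if (u i < u (i + 1))%R then (u * simple i)%g else u.
Proof.
rewrite /hecke_simple; have [asc|] := boolP (u i < u (i + 1))%R.
  suff -> : length u < length (u * simple i)%g by [].
  rewrite -{1}[u]mulg1 -(simpleK i) mulgA; apply: length_descent.
  by rewrite !permZM !simpleE; repeat case: eqP => ?; lia.
have : u i != u (i + 1)%R by rewrite (inj_eq (@permZI u)); lia.
move=> ne nlt; have /length_descent : (u (i + 1) < u i)%R by lia.
by move=> h; case: ltnP => // h2; exfalso; lia.
Qed.

Lemma hecke_simple_val (u : permZ) i x : hecke_simple u i x =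
  if (u i < u (i + 1))%R then u (simple i x) else u x.
Proof. by rewrite hecke_simpleE; case: ifP => // _; rewrite permZM. Qed.

(** Makes the choice of a reduced expression inside [hecke] harmless for the letters of a word. *)
Lemma reduced_simple i a : reduced_expression (simple i) a -> a = [:: i].
Proof.
move=> /andP[/eqP aE /eqP sa].
have : length (simple i) <= 1 by have := length_le [:: i]; rewrite big_seq1.
have siE := simpleE i i; rewrite eqxx in siE.
rewrite -sa; case: a aE {sa} => [|k [|//]].
  by rewrite big_nil => aE; move: siE; rewrite -aE permZ1; lia.
rewrite big_seq1 => kE _; congr [:: _].
move: siE; have := simpleE i (i + 1)%R; rewrite -kE !simpleE.
by repeat case: eqP => ?; lia.
Qed.

Lemma hecke_wordE a : hecke_word a = act 1%g a.
Proof.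
rewrite /hecke_word /act; move: (1%g : permZ) => u.
elim: a u => //= i a IHa u; rewrite IHa; congr foldl.
by rewrite /hecke (reduced_simple (xchooseP (reduced_expressionP (simple i)))).
Qed.

Lemma simplel i : simple i i = (i + 1)%R.
Proof. by rewrite simpleE eqxx. Qed.

Lemma simpler i : simple i (i + 1)%R = i.
Proof. by rewrite simpleE eqxx; case: eqP => ?; lia. Qed.

Lemma simple_fix i x : x != i -> x != (i + 1)%R -> simple i x = x.
Proof. by rewrite simpleE => /negPf-> /negPf->. Qed.

(** * Idempotence, commutation and braid relations; commutation classes of words *)

Lemma hecke_idem (u : permZ) i : hecke_simple (hecke_simple u i) i = hecke_simple u i.
Proof.
have [si si1] := (simplel i, simpler i).
rewrite (hecke_simpleE (hecke_simple u i)) !hecke_simple_val si si1.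
case asc : (u i < u (i + 1))%R => //; last by rewrite asc.
by case: ifP => // asc'; exfalso; lia.
Qed.

Definition far (i j : int) : bool := (i + 1 < j)%R || (j + 1 < i)%R.

Lemma hecke_comm (u : permZ) i j : far i j ->
  hecke_simple (hecke_simple u i) j = hecke_simple (hecke_simple u j) i.
Proof.
rewrite /far => ij; apply/permZP => x.
have [ij1 ij2] : simple i j = j /\ simple i (j + 1)%R = (j + 1)%R.
  by split; apply: simple_fix; lia.
have [ji1 ji2] : simple j i = i /\ simple j (i + 1)%R = (i + 1)%R.
  by split; apply: simple_fix; lia.
rewrite !hecke_simple_val ij1 ij2 ji1 ji2.
have -> : simple i (simple j x) = simple j (simple i x).
  have [->|xi] := eqVneq x i; first by rewrite ji1 !simplel.
  have [->|xi1] := eqVneq x (i + 1)%R; first by rewrite ji2 !simpler.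
  rewrite (simple_fix xi xi1).
  have [->|xj] := eqVneq x j; first by rewrite !simplel.
  have [->|xj1] := eqVneq x (j + 1)%R; first by rewrite !simpler.
  by rewrite (simple_fix xj xj1) simple_fix.
by case ci: (u i < u (i + 1))%R; case cj: (u j < u (j + 1))%R; rewrite /= ?ci ?cj.
Qed.

Lemma hecke_braid (u : permZ) i :
  hecke_simple (hecke_simple (hecke_simple u i) (i + 1)%R) i =
  hecke_simple (hecke_simple (hecke_simple u (i + 1)%R) i) (i + 1)%R.
Proof.
apply/permZP => x; rewrite !hecke_simple_val.
have := simplel (i + 1)%R; have := simpler (i + 1)%R.
have := simplel i; have := simpler i.
have : simple i (i + 1 + 1)%R = (i + 1 + 1)%R by apply: simple_fix; lia.
have : simple (i + 1)%R i = i by apply: simple_fix; lia.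
have : [\/ x = i, x = (i + 1)%R, x = (i + 1 + 1)%R |
           simple i x = x /\ simple (i + 1)%R x = x].
  have [->|x0] := eqVneq x i; first by constructor.
  have [->|x1] := eqVneq x (i + 1)%R; first by constructor.
  have [->|x2] := eqVneq x (i + 1 + 1)%R; first by constructor.
  by constructor; split; apply: simple_fix.
(* Only the recorded values of the two transpositions matter now; what remains depends on the
   relative order of [u i], [u j] and [u k]. *)
move: (simple i) (simple (i + 1)%R) => s t; move: (i + 1)%R => j.
move: (j + 1)%R => k xE t0 s2 sr sl tr tl.
rewrite !(sl, sr, s2, t0, tl, tr).
case c1: (u i < u j)%R; case c2: (u j < u k)%R; case c3: (u i < u k)%R;
  try (exfalso; clear -c1 c2 c3; lia); rewrite ?(c1, c2, c3);
  case: xE => [->|->|->|[e1 e2]];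
  rewrite ?(sl, sr, s2, t0, tl, tr) ?(e1, e2) ?(c1, c2, c3) //.
all: by case: ifP => // h; exfalso; clear -c1 c2 c3 h; lia.
Qed.

Lemma act_far i a u : all (far i) a ->
  hecke_simple (act u a) i = act (hecke_simple u i) a.
Proof.
elim: a u => //= j a IHa u /andP[ij ia].
by rewrite IHa // (hecke_comm _ ij).
Qed.

(** The first element of [s] is preceded in [s'] only by elements whose order relative to it is
    reversed, hence by letters far from it; commute it to the front and induct. *)
Lemma act_trace (T : eqType) (f : T -> int) (s s' : seq T) u :
    uniq s -> perm_eq s s' ->
    {in s &, forall x y, index x s < index y s -> index y s' < index x s' ->
      far (f x) (f y)} ->
  act u (map f s) = act u (map f s').
Proof.
elim: s s' u => [|x s IHs] s' u; first by move=> _ /perm_size; case: s'.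
move=> /= /andP[xs us] pss farf.
have xs' : x \in s' by rewrite -(perm_mem pss) mem_head.
have us' : uniq s' by rewrite -(perm_uniq pss) /= xs.
case/splitPr: xs' pss farf us' => s1 s2 pss farf us'.
have ps : perm_eq s (s1 ++ s2).
  by rewrite -(perm_cons x) (perm_trans pss) // perm_catC /= perm_cons perm_catC.
have [xs1 xs2] : x \notin s1 /\ x \notin s2.
  by move: us'; rewrite cat_uniq /= negb_or => /and4P[_ /andP[-> _] -> _].
have far1 : all (far (f x)) (map f s1).
  apply/allP => _ /mapP[y ys1 ->]; apply: farf; rewrite ?mem_head //.
  - by rewrite (perm_mem pss) mem_cat ys1.
  - by rewrite /= eqxx; case: eqVneq => // yx; rewrite yx ys1 in xs1.
  - by rewrite !index_cat ys1 (negPf xs1) /= eqxx addn0 index_mem.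
rewrite map_cat /= act_cat /= (act_far _ far1) -act_cat -map_cat.
apply: IHs => // y z ys zs yz zy.
have xy : (x == y) = false by apply: contraNF xs => /eqP->.
have xz : (x == z) = false by apply: contraNF xs => /eqP->.
apply: farf; rewrite ?inE ?ys ?zs ?orbT //= ?xy ?xz ?ltnS //.
move: zy; rewrite !index_cat /= xy xz.
have := index_mem z s1; have := index_mem y s1.
by case: (y \in s1); case: (z \in s1); clear; lia.
Qed.

(** * Words read along diagonals *)

Definition prefix_word (w : nat -> seq int) (n : nat) : seq int :=
  flatten [seq w t | t <- iota 0 n].

Lemma prefix_wordS w n : prefix_word w n.+1 = prefix_word w n ++ w n.
Proof.
by rewrite /prefix_word -addn1 iotaD map_cat flatten_cat /= cats0.
Qed.

(** Along a run of diagonals marked by [c], both words have a [j] between consecutive blocks; the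
    first word has one more [j] before the run, the second one more after it. At either end of the
    run [j] commutes with the block and merges with the next [j]. *)
Lemma prefix_first_last (P : nat -> seq int) (c : nat -> bool) (j : int) u n :
    c 0 = false ->
    (forall t, c t -> ~~ (c t.-1 && c t.+1) -> all (far j) (P t)) ->
    c n = false ->
  act u (prefix_word (fun t => nseq (c t) j ++ P t) n) =
  act u (prefix_word (fun t => P t ++ nseq (c t) j) n).
Proof.
move=> c0 farP cn.
set F := fun t => nseq (c t) j ++ P t; set L := fun t => P t ++ nseq (c t) j.
(* Inside a run the first word is one [j] behind the second; the two agree as soon as the next
   diagonal is unmarked. *)
suff [_] : act (act u (prefix_word F n)) (nseq (c n.-1) j) =
           act u (prefix_word L n) /\
   (c n = false -> act u (prefix_word F n) = act u (prefix_word L n)) by exact.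
elim: n {cn} => [|n [IHa IHb]]; first by rewrite c0.
have FS : act u (prefix_word F n.+1) =
    act (act (act u (prefix_word F n)) (nseq (c n) j)) (P n).
  by rewrite prefix_wordS act_cat {2}/F act_cat.
have LS : act u (prefix_word L n.+1) =
    act (act (act u (prefix_word L n)) (P n)) (nseq (c n) j).
  by rewrite prefix_wordS act_cat {2}/L act_cat.
rewrite FS LS /=.
case cn: (c n) => /=; last by rewrite IHb.
have HL : act (hecke_simple (act u (prefix_word F n)) j) (P n) =
    hecke_simple (act (act u (prefix_word F n)) (P n)) j \/
    c n.-1 && c n.+1.
  case: (boolP (c n.-1 && c n.+1)) => [|nc]; [by right | left].
  by symmetry; apply: act_far; apply: farP.
have main : hecke_simple (act (hecke_simple (act u (prefix_word F n)) j) (P n)) j =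
    hecke_simple (act (act u (prefix_word L n)) (P n)) j.
  move: IHa; case cn1: (c n.-1) => /= IHa; first by rewrite IHa.
  by case: HL; rewrite ?cn1 // => ->; rewrite hecke_idem IHa.
split=> // cS; rewrite -main.
by case: HL; rewrite ?cS ?andbF // => ->; rewrite hecke_idem.
Qed.

(* [ha], [hb] and [bul] tell which diagonals contain [a], [b = a + 1] and a
   bullet, and [P] lists the other entries.  The invariant [Q]: after each diagonal
   without bullet the two prefixes agree, except that the second one still lacks
   a factor [b] when both [a] and [b] occur on that diagonal; and the first prefix
   absorbs further copies of the letters [a], [b] that occur there. *)
Lemma diagonal_exchange (P : nat -> seq int) (ha hb bul : nat -> bool) (a : int) u n :
    let b := (a + 1)%R in
    [/\ ha 0 = false, hb 0 = false, bul 0 = false & P 0 = [::]] ->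
    (forall t, bul t -> [/\ ~~ bul t.+1, ~~ ha t & ~~ hb t]) ->
    (forall t, ha t -> all (far a) (P t)) ->
    (forall t, hb t -> all (far b) (P t)) ->
    (forall t, bul t.+1 -> ~~ (ha t && ha t.+2) -> all (far a) (P t.+1)) ->
    (forall t, bul t.+1 -> ~~ (hb t && hb t.+2) -> all (far b) (P t.+1)) ->
    (forall t, ha t.+1 -> hb t.+1 -> bul t && bul t.+2) ->
    bul n = false -> bul n.+1 = false ->
  act u (prefix_word (fun t => P t ++ nseq (hb t) b ++
      nseq (ha t || bul t && (ha t.-1 || ha t.+1)) a) n.+1) =
  act u (prefix_word (fun t => nseq (hb t || bul t && (hb t.-1 || hb t.+1)) b ++
      P t ++ nseq (ha t) a) n.+1).
Proof.
move=> b [ha0 hb0 bul0 P0] bulP haP hbP bula bulb hab nn nn1.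
set W := (fun t => _); set V := (fun t => nseq (hb t || _) _ ++ _).
pose w t := act u (prefix_word W t.+1); pose v t := act u (prefix_word V t.+1).
have braid x : hecke_simple (hecke_simple (hecke_simple x a) b) a =
               hecke_simple (hecke_simple (hecke_simple x b) a) b.
  exact: hecke_braid.
pose Q t := [/\ (if ha t && hb t then hecke_simple (v t) b else v t) = w t,
  ha t -> hecke_simple (w t) a = w t & hb t -> hecke_simple (w t) b = w t].
suff Qt t : ~~ bul t -> Q t.
  (* The correction factor in [Q n] is absent: both letters on diagonal [n] would force a bullet on
     diagonal [n.+1]. *)
  have [] := Qt n (negbT nn); rewrite -/(w n) -/(v n).
  case: ifP => [/andP[han hbn] _ _ _|_ -> //].
  by case: n {Qt} nn nn1 han hbn => [|n] nn nn1 han hbn;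
    [rewrite ha0 in han | have := hab n han hbn; rewrite nn1 andbF].
have wS s : w s.+1 = act (act (act (w s) (P s.+1)) (nseq (hb s.+1) b))
    (nseq (ha s.+1 || bul s.+1 && (ha s || ha s.+2)) a).
  by rewrite /w prefix_wordS act_cat {2}/W !act_cat.
have vS s : v s.+1 = act (act (act (v s)
    (nseq (hb s.+1 || bul s.+1 && (hb s || hb s.+2)) b)) (P s.+1))
    (nseq (ha s.+1) a).
  by rewrite /v prefix_wordS act_cat {2}/V !act_cat.
(* [Q] is claimed only off the bullets, so a bullet diagonal is crossed together with the one after
   it; hence strong induction. *)
elim/ltn_ind: t => -[|t] IHt nbt.
  rewrite /Q /w /v /prefix_word /= /W /V ha0 hb0 bul0 P0 /=.
  by split.
have [bt|nbt0] := boolP (bul t); last first.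
  have [] := IHt t (ltnSn t) nbt0.
  case: ifP => [/andP[hat hbt]|_ vw _ _].
    case: t hat hbt nbt {IHt nbt0} => [|t] hat hbt nbt; first by rewrite ha0 in hat.
    by have := hab t hat hbt; rewrite (negPf nbt) andbF.
  have nab : ha t.+1 && hb t.+1 = false.
    by apply/negP => /andP[x1 x2]; have := hab t x1 x2; rewrite (negPf nbt0).
  rewrite /Q wS vS vw (negPf nbt) !orbF nab.
  case: (ha t.+1) nab (haP t.+1); case hb1: (hb t.+1) (hbP t.+1) => //= fb _ fa;
    split=> //; rewrite ?hecke_idem //.
  by rewrite (@act_far b (P t.+1)) ?fb.
case: t IHt nbt bt => [|t] IHt nbt bt; first by rewrite bul0 in bt.
have [nb2 na1 nb1] := bulP _ bt.
have nbt0 : ~~ bul t by apply/negP => /bulP[]; rewrite bt.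
have [Qa Qwa Qwb] := IHt t (ltnW (ltnSn _)) nbt0.
rewrite /Q wS wS vS vS (negPf na1) (negPf nb1) bt (negPf nb2) /= !orbF.
have fa := bula t bt; have fb := bulb t bt.
have fa2 := haP t.+2; have fb2 := hbP t.+2.
set X := act (act (w t) (P t.+1)) (P t.+2).
pose V2 := act (act (act (act (act (v t) (nseq (hb t || hb t.+2) b)) (P t.+1))
  (nseq (hb t.+2) b)) (P t.+2)) (nseq (ha t.+2) a).
pose W2 := act (act (act (act (act (w t) (P t.+1)) (nseq (ha t || ha t.+2) a))
  (P t.+2)) (nseq (hb t.+2) b)) (nseq (ha t.+2) a).
rewrite -/V2 -/W2.
(* If [hb t], the [b] of the bullet diagonal supplies the factor missing in [Q t] or is absorbed by
   [w t]. Otherwise it commutes past [P t.+1] and merges with the [b] of diagonal [t.+2]. *)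
have V2E : V2 = act (act X (nseq (hb t.+2) b)) (nseq (ha t.+2) a).
  rewrite /V2 /X; congr act.
  have -> : act (act (v t) (nseq (hb t || hb t.+2) b)) (P t.+1) =
      act (act (w t) (P t.+1)) (nseq (~~ hb t && hb t.+2) b).
    case hbt: (hb t) Qa Qwb fb => /=.
      rewrite andbT; case: (ha t) => [-> //|-> ->] //.
    rewrite andbF => -> _; case: (hb t.+2) => //= fb.
    by rewrite -(@act_far b (P t.+1)) ?fb // hecke_idem.
  case hb2: (hb t.+2) fb2 => /= fb2; last by rewrite andbF.
  rewrite (@act_far b (P t.+2)) ?fb2 //; case: (hb t) => //=.
  by rewrite hecke_idem.
(* The [a] of the bullet diagonal is pushed right past [P t.+2] if [ha t.+2]; otherwise it is pulled
   back past [P t.+1] and absorbed by [w t]. *)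
have W2E : W2 = act (act (act X (nseq (ha t.+2) a)) (nseq (hb t.+2) b))
                    (nseq (ha t.+2) a).
  rewrite /W2 /X; do 2 congr act.
  case ha2: (ha t.+2) fa2 fa => /= fa2.
    by rewrite orbT /= (@act_far a (P t.+2)) ?fa2.
  rewrite andbF orbF; case hat: (ha t) Qwa => //= Qwa fa.
  by rewrite (@act_far a (P t.+1)) ?fa // Qwa.
rewrite V2E W2E.
(* With both letters present this is the braid relation, its third letter being the correction
   factor of [Q]; the other cases need idempotence only. *)
case: (ha t.+2); case: (hb t.+2); split=> //=.
- by rewrite hecke_idem.
- by rewrite braid hecke_idem.
all: by rewrite hecke_idem.
Qed.

(** * Tableaux with bullets *)

Lemma neighborsE (x y : box) : neighbors x y =
  [|| (y.1 == x.1.+1) && (y.2 == x.2), (y.1 == x.1) && (y.2 == x.2.+1),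
      (x.1 == y.1.+1) && (x.2 == y.2) | (x.1 == y.1) && (x.2 == y.2.+1)].
Proof.
by case: x y => [a b] [c d]; rewrite /neighbors !coversE -!pair_eqE /=; lia.
Qed.

(** The domain of a tableau with bullets enters the argument only through this property, which holds
    for forward and reverse slides alike. *)
Definition convex (D : {fset box}) : Prop := forall x y z : box,
  x \in D -> y \in D -> (x <= z)%O -> (z <= y)%O -> z \in D.

(* Orders values and bullets so that bullets lie strictly between [i] and [i + 1]. *)
Definition bullet_key (i : int) (o : option int) : int :=
  if o is Some v then (v *+ 2)%R else (i *+ 2 + 1)%R.

Definition increasing_at (D : {fset box}) (i : int) (f : box -> option int) : Prop :=
  {in D &, forall x y, (x < y)%O -> (bullet_key i (f x) < bullet_key i (f y))%R}.

(* [N] exceeds all row indices in use, so that contents are positive and the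
   subtraction is not truncated. *)
Definition content (N : nat) (x : box) : nat := x.2 + N - x.1.

Definition diagonal (D : {fset box}) (N t : nat) : seq box :=
  [seq x <- enum_fset D | content N x == t].

Definition on_diagonal D N (f : box -> option int) o t : bool :=
  has (fun x => f x == o) (diagonal D N t).

Definition adjacent_to (D : {fset box}) (f : box -> option int) o x : bool :=
  has (fun y => neighbors x y && (f y == o)) (enum_fset D).

Definition filled D (f : box -> option int) (j : int) (x : box) : bool :=
  (f x == Some j) || (f x == None) && adjacent_to D f (Some j) x.

(** The default 0 is never read: bullets are filtered out beforehand. *)
Definition box_value (f : box -> option int) (x : box) : int := odflt 0%R (f x).

Definition entries_except D N (f : box -> option int) (s : seq (option int)) t
    : seq int :=
  map (box_value f) [seq x <- diagonal D N t | f x \notin None :: s].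

(** One letter [j] per diagonal is enough: for the values [j] next to the bullets, at most one box
    of a diagonal is filled. *)
Definition first_word D N f j :=
  prefix_word (fun t => nseq (has (filled D f j) (diagonal D N t)) j ++
                        entries_except D N f [:: Some j] t).

Definition last_word D N f j :=
  prefix_word (fun t => entries_except D N f [:: Some j] t ++
                        nseq (has (filled D f j) (diagonal D N t)) j).

(** The operation [swap] on functions defined on all boxes, with [D] fixed once and for all. *)
Definition slide_step D (f : box -> option int) (j : int) (x : box) : option int :=
  if x \notin D then f x
  else if (f x == Some j) && adjacent_to D f None x then None
  else if (f x == None) && adjacent_to D f (Some j) x then Some j
  else f x.

Lemma adjacent_toP (D : {fset box}) f o x :
  reflect (exists y, [/\ y \in D, neighbors x y & f y = o]) (adjacent_to D f o x).
Proof.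
apply: (iffP hasP) => [[y yD /andP[xy /eqP fy]]|[y [yD xy fy]]]; exists y => //.
by rewrite xy fy eqxx.
Qed.

Lemma neighborsC x y : neighbors x y = neighbors y x.
Proof. by rewrite /neighbors orbC. Qed.

(** * Diagonals of increasing fillings with bullets *)

Section Diagonals.

Variables (D : {fset box}) (N : nat).
Hypothesis D_convex : convex D.
Hypothesis D_rows : forall x, x \in D -> x.1 < N.

Lemma mem_diagonal x t : (x \in diagonal D N t) = (x \in D) && (content N x == t).
Proof. by rewrite mem_filter andbC. Qed.

Lemma on_diagonalP f o t :
  reflect (exists x, [/\ x \in D, content N x = t & f x = o]) (on_diagonal D N f o t).
Proof.
apply: (iffP hasP) => [[x]|[x [xD xt fx]]].
  by rewrite mem_diagonal => /andP[xD /eqP xt] /eqP fx; exists x.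
by exists x; rewrite ?mem_diagonal ?xD ?xt ?fx eqxx.
Qed.

Section Increasing.

Variables (i : int) (f : box -> option int).
Hypothesis f_incr : increasing_at D i f.
Local Notation key x := (bullet_key i (f x)).

Lemma key_lt x y : x \in D -> y \in D -> x.1 <= y.1 -> x.2 <= y.2 ->
  x.1 + x.2 < y.1 + y.2 -> (key x < key y)%R.
Proof. by move=> xD yD *; apply: f_incr => //; rewrite box_ltE; apply/and3P. Qed.

(** The witnesses are the boxes right of [x] and below [x], which lie in [D] by convexity. *)
Lemma key_between x y : x \in D -> y \in D -> x.1 < y.1 -> x.2 < y.2 ->
  exists z1 z2, [/\ z1 \in D, z2 \in D, content N z1 = (content N x).+1,
    content N z2 = (content N x).-1
    & (key x < key z1 < key y)%R /\ (key x < key z2 < key y)%R].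
Proof.
case: x y => [a b] [c d] xD yD /= ac bd; have /= aN := D_rows xD.
have z1D : (a, b.+1) \in D by apply: (D_convex xD yD); rewrite box_leE /=; lia.
have z2D : (a.+1, b) \in D by apply: (D_convex xD yD); rewrite box_leE /=; lia.
exists (a, b.+1), (a.+1, b); split => //; rewrite /content /=; try lia.
by split; apply/andP; split; apply: key_lt => //=; lia.
Qed.

Lemma diagonal_trichotomy x y : x \in D -> y \in D -> content N x = content N y ->
  [\/ x = y, x.1 < y.1 /\ x.2 < y.2 | y.1 < x.1 /\ y.2 < x.2].
Proof.
case: x y => [a b] [c d] /D_rows /= aN /D_rows /= cN; rewrite /content /= => e.
have [ac|ca|ac] := ltngtP a c; [constructor 2 | constructor 3 | constructor 1]; try lia.
by congr (_, _); lia.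
Qed.

(** Boxes on consecutive diagonals are comparable. If they are not neighbors, convexity provides a
    box strictly between them, so their keys differ by at least 2. *)
Lemma adjacent_diagonals x y : x \in D -> y \in D -> content N y = (content N x).+1 ->
  (key x != key y) /\ (`|key x - key y|%R = 1%R -> neighbors x y).
Proof.
case: x y => [a b] [c d] xD yD; have /= aN := D_rows xD; have /= cN := D_rows yD.
rewrite /content /= => e; have [ac|ca] := leqP a c.
  have lt : (key (a, b) < key (c, d))%R by apply: key_lt => //=; lia.
  split=> [|k1]; first by rewrite lt_eqF.
  rewrite neighborsE /=; have [ac'|ac'] := eqVneq a c; first by lia.
  have zD : (a, b.+1) \in D by apply: (D_convex xD yD); rewrite box_leE /=; lia.
  have : (key (a, b) < key (a, b.+1))%R by apply: key_lt => //=; lia.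
  have : (key (a, b.+1) < key (c, d))%R by apply: key_lt => //=; lia.
  move: k1; move: (bullet_key i (f (a, b))) (bullet_key i (f (c, d))).
  by move: (bullet_key i (f (a, b.+1))) => k l m; lia.
have lt : (key (c, d) < key (a, b))%R by apply: key_lt => //=; lia.
split=> [|k1]; first by rewrite gt_eqF.
rewrite neighborsE /=; have [bd|bd] := eqVneq b d; first by lia.
have zD : (a.-1, b) \in D by apply: (D_convex yD xD); rewrite box_leE /=; lia.
have : (key (c, d) < key (a.-1, b))%R by apply: key_lt => //=; lia.
have : (key (a.-1, b) < key (a, b))%R by apply: key_lt => //=; lia.
move: k1; move: (bullet_key i (f (a, b))) (bullet_key i (f (c, d))).
by move: (bullet_key i (f (a.-1, b))) => k l m; lia.
Qed.

Lemma neighbors_content x y : x \in D -> y \in D -> neighbors x y ->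
  content N y = (content N x).+1 \/ content N y = (content N x).-1 /\ 0 < content N x.
Proof.
case: x y => [a b] [c d] /D_rows /= aN /D_rows /= cN.
by rewrite neighborsE /content /=; lia.
Qed.

Lemma content_gt0 x : x \in D -> 0 < content N x.
Proof. by case: x => [a b] /D_rows /= aN; rewrite /content /=; lia. Qed.

Lemma neighbors_key x y : x \in D -> y \in D -> neighbors x y -> key x != key y.
Proof.
move=> xD yD xy; have [cy|[cy cx]] := neighbors_content xD yD xy.
  by have [] := adjacent_diagonals xD yD cy.
rewrite eq_sym; have [] // := adjacent_diagonals yD xD _.
by rewrite cy; lia.
Qed.

Lemma key_value x k : key x = (k *+ 2)%R -> f x = Some k.
Proof. by case: (f x) => [v|] /= e; [congr Some; lia | lia]. Qed.

Lemma key_bullet x : key x = (i *+ 2 + 1)%R -> f x = None.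
Proof. by case: (f x) => [v|] /= e; [lia | ]. Qed.

(** The key of a bullet differs by 1 from that of [i] and of [i + 1], so a bullet and a [j] on
    adjacent diagonals are automatically neighbors. *)
Lemma has_filled j t : j = i \/ j = (i + 1)%R ->
  has (filled D f j) (diagonal D N t) =
  on_diagonal D N f (Some j) t || on_diagonal D N f None t &&
    (on_diagonal D N f (Some j) t.-1 || on_diagonal D N f (Some j) t.+1).
Proof.
move=> ji; apply/idP/idP.
  case/hasP => x; rewrite mem_diagonal => /andP[xD /eqP xt] /orP[/eqP fx|].
    by apply/orP; left; apply/on_diagonalP; exists x.
  move=> /andP[/eqP fx /adjacent_toP[y [yD xy fy]]].
  apply/orP; right; apply/andP; split; first by apply/on_diagonalP; exists x.
  have [cy|[cy _]] := neighbors_content xD yD xy; apply/orP; [right|left];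
    by apply/on_diagonalP; exists y; rewrite cy xt.
case/orP => [/on_diagonalP[x [xD xt fx]]|/andP[/on_diagonalP[x [xD xt fx]] h]].
  by apply/hasP; exists x; rewrite ?mem_diagonal ?xD ?xt /filled ?fx ?eqxx.
apply/hasP; exists x; first by rewrite mem_diagonal xD xt eqxx.
rewrite /filled fx /=; apply/adjacent_toP.
have kd y : f y = Some j -> `|key x - key y|%R = 1%R.
  by rewrite fx => -> /=; case: ji => ->; lia.
case/orP: h => /on_diagonalP[y [yD yt fy]]; exists y; split=> //.
  rewrite neighborsC; have [|_ ] := adjacent_diagonals yD xD.
    by have := content_gt0 xD; lia.
  by apply; rewrite distrC kd.
have [|_ ] := adjacent_diagonals xD yD; first by lia.
by apply; rewrite kd.
Qed.

(** A box between the two forces a gap of at least 2, unless it is a bullet separating [i] from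
    [i + 1]. *)
Lemma diagonal_far x y v w : x \in D -> y \in D -> content N x = content N y ->
    x <> y -> f x = Some v -> f y = Some w ->
  [\/ far v w, (v = i /\ w = i + 1)%R | (v = i + 1 /\ w = i)%R].
Proof.
move=> xD yD xy nxy fx fy; have [//|[h1 h2]|[h1 h2]] := diagonal_trichotomy xD yD xy.
  have [z [_ [_ _ _ _ [+ _]]]] := key_between xD yD h1 h2.
  rewrite fx fy /far; case: (f z) => [k|] /= kz; first by constructor 1; lia.
  have [vi|vi] := eqVneq v i; last by constructor 1; lia.
  have [wi|wi] := eqVneq w (i + 1)%R; last by constructor 1; lia.
  by constructor 2.
have [z [_ [_ _ _ _ [+ _]]]] := key_between yD xD h1 h2.
rewrite fx fy /far; case: (f z) => [k|] /= kz; first by constructor 1; lia.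
have [vi|vi] := eqVneq v (i + 1)%R; last by constructor 1; lia.
have [wi|wi] := eqVneq w i; last by constructor 1; lia.
by constructor 3.
Qed.

Lemma diagonal_value q t : q = i \/ q = (i + 1)%R ->
  map (box_value f) [seq x <- diagonal D N t | f x == Some q] =
  nseq (on_diagonal D N f (Some q) t) q.
Proof.
move=> qi; set s := filter _ _.
have sP x : x \in s -> [/\ x \in D, content N x = t & f x = Some q].
  by rewrite mem_filter mem_diagonal => /and3P[/eqP ? ? /eqP].
have us : uniq s by rewrite !filter_uniq // fset_uniq.
rewrite /on_diagonal has_filter -/s.
case: s us sP => [|x [|y s]] //= us sP.
  by have [_ _ fx] := sP x (mem_head _ _); rewrite /box_value fx.
have [xD xt fx] := sP x (mem_head _ _).
have [|yD yt fy] := sP y; first by rewrite !inE eqxx orbT.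
have xy : x <> y by move=> xy; move: us; rewrite xy mem_head.
have := diagonal_far xD yD (etrans xt (esym yt)) xy fx fy.
by rewrite /far => -[|[]|[]]; lia.
Qed.

(** Once [p] is left out, the entries of a diagonal commute pairwise, so [q] may be read last. *)
Lemma act_entries p q t u : (p = i /\ q = i + 1 \/ p = i + 1 /\ q = i)%R ->
  act u (entries_except D N f [:: Some p] t) =
  act u (entries_except D N f [:: Some p; Some q] t ++
         nseq (on_diagonal D N f (Some q) t) q).
Proof.
move=> pq; rewrite -diagonal_value; last by case: pq => -[_ ->]; [right | left].
rewrite -map_cat /entries_except.
set s := filter _ _; set s' := _ ++ _.
have sP x : x \in s ->
    [/\ x \in D, content N x = t & exists2 v, f x = Some v & v <> p].
  rewrite mem_filter mem_diagonal !inE => /and3P[+ ? /eqP].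
  case: (f x) => [v|] //= /eqP vp xt; split=> //; exists v => // e.
  by apply: vp; rewrite e.
apply: act_trace; first by rewrite !filter_uniq // fset_uniq.
  suff -> : s' = filter (fun x => f x != Some q) s ++
      filter (predC (fun x => f x != Some q)) s.
    by rewrite perm_sym; apply/permPl/perm_filterC.
  rewrite /s'; congr (_ ++ _); rewrite -[RHS]filter_predI; apply: eq_filter => x /=.
    by rewrite !inE; do 3 case: (f x == _).
  rewrite negbK !inE; case: eqP => //= ->; apply/esym.
  by case: pq => -[-> ->]; apply/eqP => -[]; lia.
move=> x y xs ys xy _; have [xD xt [v fx vp]] := sP x xs.
have [yD yt [w fy wp]] := sP y ys.
have nxy : x <> y by move=> e; rewrite e ltnn in xy.
rewrite /box_value fx fy /=.
by have [//|[]|[]] := diagonal_far xD yD (etrans xt (esym yt)) nxy fx fy; lia.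
Qed.

Lemma entriesP s t v : v \in entries_except D N f s t ->
  exists x, [/\ x \in D, content N x = t, f x = Some v & Some v \notin s].
Proof.
case/mapP => x; rewrite mem_filter mem_diagonal inE negb_or.
move=> /andP[/andP[fN fs] /andP[xD /eqP xt]] vE; exists x.
by move: vE fN fs; rewrite /box_value; case: (f x) => //= w ->.
Qed.

Lemma entries_far_same s q t : q = i \/ q = (i + 1)%R ->
    Some i \in s -> Some (i + 1)%R \in s ->
    on_diagonal D N f (Some q) t -> all (far q) (entries_except D N f s t).
Proof.
move=> qi si si1 /on_diagonalP[x [xD xt fx]]; apply/allP => v /entriesP.
move=> [y [yD yt fy vs]]; have xy : x <> y.
  move=> e; rewrite e fy in fx; case: fx => e'; rewrite e' in vs.
  by case: qi => qi; rewrite qi ?si ?si1 in vs.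
have [//|[_ e]|[_ e]] := diagonal_far xD yD (etrans xt (esym yt)) xy fx fy;
  by rewrite e ?si ?si1 in vs.
Qed.

(** The only listed value that could fail to be far from [i] is [i - 1]. It would lie northwest of
    the bullet, and both boxes following it, on the two adjacent diagonals, could only hold [i]. *)
Lemma entries_far_low s t : Some i \in s -> Some (i + 1)%R \in s ->
    on_diagonal D N f None t.+1 ->
    ~~ (on_diagonal D N f (Some i) t && on_diagonal D N f (Some i) t.+2) ->
  all (far i) (entries_except D N f s t.+1).
Proof.
move=> si si1 /on_diagonalP[x [xD xt fx]] noi; apply/allP => v /entriesP.
move=> [y [yD yt fy vs]]; apply: contraNT noi; rewrite /far => nfar.
have vi : v != i by apply: contraNneq vs => ->.
have vi1 : v != (i + 1)%R by apply: contraNneq vs => ->.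
have {vi vi1} vE : v = (i - 1)%R by lia.
have [e|[h1 h2]|[h1 h2]] := diagonal_trichotomy xD yD (etrans xt (esym yt)).
- by rewrite e fy in fx.
- have [z [_ [_ _ _ _ [+ _]]]] := key_between xD yD h1 h2.
  by rewrite fx fy /=; lia.
have [z1 [z2 [z1D z2D c1 c2 [k1 k2]]]] := key_between yD xD h1 h2.
rewrite fx fy vE /= in k1 k2.
by apply/andP; split; apply/on_diagonalP; [exists z2 | exists z1];
  rewrite ?c1 ?c2 yt; split=> //; apply: key_value; move: k1 k2;
  [case: (f z2) | case: (f z1)] => /= *; lia.
Qed.

(** Mirror image of the previous argument, with [i + 2] southeast of the bullet. *)
Lemma entries_far_high s t : Some i \in s -> Some (i + 1)%R \in s ->
    on_diagonal D N f None t.+1 ->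
    ~~ (on_diagonal D N f (Some (i + 1)%R) t &&
        on_diagonal D N f (Some (i + 1)%R) t.+2) ->
  all (far (i + 1)%R) (entries_except D N f s t.+1).
Proof.
move=> si si1 /on_diagonalP[x [xD xt fx]] noi; apply/allP => v /entriesP.
move=> [y [yD yt fy vs]]; apply: contraNT noi; rewrite /far => nfar.
have vi : v != i by apply: contraNneq vs => ->.
have vi1 : v != (i + 1)%R by apply: contraNneq vs => ->.
have {vi vi1} vE : v = (i + 1 + 1)%R by lia.
have [e|[h1 h2]|[h1 h2]] := diagonal_trichotomy xD yD (etrans xt (esym yt)).
- by rewrite e fy in fx.
- have [z1 [z2 [z1D z2D c1 c2 [k1 k2]]]] := key_between xD yD h1 h2.
  rewrite fx fy vE /= in k1 k2.
  by apply/andP; split; apply/on_diagonalP; [exists z2 | exists z1];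
    rewrite ?c1 ?c2 xt; split=> //; apply: key_value; move: k1 k2;
    [case: (f z2) | case: (f z1)] => /= *; lia.
have [z [_ [_ _ _ _ [+ _]]]] := key_between yD xD h1 h2.
by rewrite fx fy /=; lia.
Qed.

(** Bullets have equal keys, and no key fits strictly between a bullet and [i] or [i + 1]. *)
Lemma bullet_diagonal t : on_diagonal D N f None t ->
  [/\ ~~ on_diagonal D N f None t.+1, ~~ on_diagonal D N f (Some i) t &
      ~~ on_diagonal D N f (Some (i + 1)%R) t].
Proof.
case/on_diagonalP => x [xD xt fx]; split; apply/negP => /on_diagonalP[y [yD yt fy]].
- have [|+ _] := adjacent_diagonals xD yD; first by rewrite xt yt.
  by rewrite fx fy eqxx.
- have [e|[h1 h2]|[h1 h2]] := diagonal_trichotomy xD yD (etrans xt (esym yt)).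
  + by rewrite e fy in fx.
  + have [z [_ [_ _ _ _ [+ _]]]] := key_between xD yD h1 h2.
    by rewrite fx fy /=; lia.
  have [z [_ [_ _ _ _ [+ _]]]] := key_between yD xD h1 h2.
  by rewrite fx fy /=; case: (f z) => [v|] /=; lia.
have [e|[h1 h2]|[h1 h2]] := diagonal_trichotomy xD yD (etrans xt (esym yt)).
- by rewrite e fy in fx.
- have [z [_ [_ _ _ _ [+ _]]]] := key_between xD yD h1 h2.
  by rewrite fx fy /=; case: (f z) => [v|] /=; lia.
have [z [_ [_ _ _ _ [+ _]]]] := key_between yD xD h1 h2.
by rewrite fx fy /=; lia.
Qed.

(** Only bullets fit between [i] and [i + 1], and there is a box between them on each adjacent
    diagonal. *)
Lemma consecutive_diagonal t : on_diagonal D N f (Some i) t.+1 ->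
    on_diagonal D N f (Some (i + 1)%R) t.+1 ->
  on_diagonal D N f None t && on_diagonal D N f None t.+2.
Proof.
case/on_diagonalP => x [xD xt fx]; case/on_diagonalP => y [yD yt fy].
have [e|[h1 h2]|[h1 h2]] := diagonal_trichotomy xD yD (etrans xt (esym yt)).
- by move: fx; rewrite e fy => -[]; lia.
- have [z1 [z2 [z1D z2D c1 c2 [k1 k2]]]] := key_between xD yD h1 h2.
  rewrite fx fy /= in k1 k2.
  by apply/andP; split; apply/on_diagonalP; [exists z2 | exists z1];
    rewrite ?c1 ?c2 xt; split=> //; apply: key_bullet; move: k1 k2;
    [case: (f z2) | case: (f z1)] => /= *; lia.
have [z [_ [_ _ _ _ [+ _]]]] := key_between yD xD h1 h2.
by rewrite fx fy /=; lia.
Qed.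

Lemma no_diagonal0 o : on_diagonal D N f o 0 = false.
Proof. by apply/negP => /on_diagonalP[x [/content_gt0 + x0]]; rewrite x0. Qed.

Lemma no_diagonal o t : (forall x, x \in D -> content N x < t) ->
  on_diagonal D N f o t = false.
Proof. by move=> h; apply/negP => /on_diagonalP[x [/h + xt]]; rewrite xt ltnn. Qed.

(** * Comparison of the fillings of the bullets with [i] and with [i + 1] *)

Lemma act_prefix_word (w w' : nat -> seq int) n u :
  (forall t u, act u (w t) = act u (w' t)) ->
  act u (prefix_word w n) = act u (prefix_word w' n).
Proof.
move=> ww'; elim: n => // n IHn.
by rewrite !prefix_wordS !act_cat IHn ww'.
Qed.

(** Splitting off both [i] and [i + 1] on every diagonal brings the two words to the form handled by
    [diagonal_exchange]. *)
Lemma last_word_shift M u : (forall x, x \in D -> content N x < M) ->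
  act u (last_word D N f i M.+1) = act u (first_word D N f (i + 1)%R M.+1).
Proof.
move=> hM; pose R := entries_except D N f [:: Some i; Some (i + 1)%R].
have RE t : entries_except D N f [:: Some (i + 1)%R; Some i] t = R t.
  congr map; apply: eq_filter => x; rewrite !inE; congr (~~ (_ || _)).
  exact: orbC.
set b := (i + 1)%R in R RE *.
pose h k := on_diagonal D N f (Some k); pose bul := on_diagonal D N f None.
pose marked k t := h k t || bul t && (h k t.-1 || h k t.+1).
transitivity (act u (prefix_word
    (fun t => R t ++ nseq (h b t) b ++ nseq (marked i t) i) M.+1)).
  apply: act_prefix_word => t v; rewrite has_filled; last by left.
  by rewrite catA !act_cat (@act_entries i b) ?act_cat //; left.
transitivity (act u (prefix_word
    (fun t => nseq (marked b t) b ++ R t ++ nseq (h i t) i) M.+1)); last first.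
  apply: act_prefix_word => t v; rewrite has_filled; last by right.
  by rewrite !act_cat (@act_entries b i) ?act_cat ?RE //; right.
have si : Some i \in [:: Some i; Some (i + 1)%R] by rewrite mem_head.
have si1 : Some (i + 1)%R \in [:: Some i; Some (i + 1)%R] by rewrite !inE eqxx orbT.
apply: diagonal_exchange.
- rewrite /h /bul !no_diagonal0; split=> //; rewrite /R /entries_except.
  rewrite -(@eq_in_filter _ pred0) ?filter_pred0 // => x.
  by rewrite mem_diagonal => /andP[/content_gt0 + /eqP x0]; rewrite x0.
- exact: bullet_diagonal.
- by move=> t; apply: entries_far_same => //; left.
- by move=> t; apply: entries_far_same => //; right.
- by move=> t; apply: entries_far_low.
- by move=> t; apply: entries_far_high.
- exact: consecutive_diagonal.
(* Contents are below [M], so the diagonals [M] and [M.+1] are empty. *)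
- exact: no_diagonal.
- by apply: no_diagonal => x /hM xM; apply: ltnW.
Qed.

(** On a filled diagonal, an entry that does not commute with [i + 1] is [i], beside an [i + 1], or
    [i + 2], beside a bullet. The first forces bullets, the second forces [i + 1], on both adjacent
    diagonals, so these are filled too. *)
Lemma first_word_last M u : (forall x, x \in D -> content N x < M) ->
  act u (first_word D N f (i + 1)%R M) = act u (last_word D N f (i + 1)%R M).
Proof.
move=> hM; apply: prefix_first_last.
- by rewrite has_filled ?no_diagonal0 //; right.
- move=> t; rewrite !has_filled; try by right.
  set h := on_diagonal D N f (Some (i + 1)%R); set bul := on_diagonal D N f None => ht nh.
  apply/allP => v vt; have /entriesP[x [xD xt fx vi1]] := vt.
  apply: contraNT nh => nfar.
  have {}vi1 : v <> (i + 1)%R by move=> e; rewrite e mem_head in vi1.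
  case: t ht xt vt => [|t] ht xt vt; first by have := content_gt0 xD; rewrite xt.
  case/orP: ht => [ht|/andP[bt _]].
    have vi : v = i.
      case/on_diagonalP: (ht) => y [yD yt fy]; have xy : x <> y.
        by move=> e; rewrite e fy in fx; case: fx => /esym.
      have [|[]|[]] // := diagonal_far xD yD (etrans xt (esym yt)) xy fx fy.
      by move: nfar; rewrite /far; lia.
    have : bul t && bul t.+2.
      by apply: consecutive_diagonal => //; apply/on_diagonalP; exists x; rewrite fx vi.
    by case/andP => /= -> ->; rewrite ht !orbT.
  have [hh|nh] := boolP (h t && h t.+2); first by case/andP: hh => /= -> ->.
  have [_ ni _] := bullet_diagonal bt.
  have vi : v <> i.
    by move=> e; case/negP: ni; apply/on_diagonalP; exists x; rewrite fx e.
  have : v \in entries_except D N f [:: Some i; Some (i + 1)%R] t.+1.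
    apply/mapP; exists x; last by rewrite /box_value fx.
    rewrite mem_filter mem_diagonal xD xt eqxx fx !inE !negb_or /= andbT.
    by apply/andP; split; apply/eqP => -[].
  have /allP far2 := entries_far_high (mem_head _ _) (mem_last (Some i) [:: _]) bt nh.
  by move=> /far2; rewrite (negPf nfar).
- by rewrite has_filled ?(no_diagonal _ hM) //; right.
Qed.

End Increasing.
End Diagonals.

(** * Slides *)

Definition bounded (D : {fset box}) (a b : int) (f : box -> option int) : Prop :=
  forall x v, x \in D -> f x = Some v -> (a <= v <= b)%R.

Definition content_word D N f := prefix_word (entries_except D N f [::]).

Lemma bounded_slide D a b f j : (a <= j <= b)%R -> bounded D a b f ->
  bounded D a b (slide_step D f j).
Proof.
move=> jab fab x v xD; rewrite /slide_step xD /=; case: ifP => // _.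
by case: ifP => [_ [<-]|_ /fab]; last exact.
Qed.

(** If [j] is not a possible value, no bullet is filled and no entry is set apart. *)
Lemma last_word_content D N f a b j n : bounded D a b f -> ~~ (a <= j <= b)%R ->
  last_word D N f j n = content_word D N f n.
Proof.
move=> fab jab; have fj x : x \in D -> (f x == Some j) = false.
  by move=> xD; apply: contraNF jab => /eqP /(fab _ _ xD).
rewrite /last_word /content_word /prefix_word; congr flatten; apply: eq_map => t.
have -> : has (filled D f j) (diagonal D N t) = false.
  apply/hasPn => x; rewrite mem_diagonal => /andP[xD _].
  rewrite /filled fj //= negb_and; apply/orP; right; apply/adjacent_toP.
  by case=> y [yD _ /eqP]; rewrite fj.
rewrite cats0 /entries_except; congr map; apply: eq_in_filter => x.
by rewrite mem_diagonal => /andP[xD _]; rewrite !inE fj // orbF.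
Qed.

(** A [j] that turns into a bullet has a neighbor that turns into [j], and conversely, so the filled
    boxes are the same. *)
Lemma last_word_slide D N f j n :
    {in D &, forall x y, neighbors x y -> f x = None -> f y <> None} ->
  last_word D N (slide_step D f j) j n = last_word D N f j n.
Proof.
move=> nbul; rewrite /last_word /prefix_word; congr flatten; apply: eq_map => t.
congr (_ ++ nseq _ _).
  rewrite /entries_except.
  have sE x : f x \notin [:: None; Some j] -> slide_step D f j x = f x.
    rewrite !inE negb_or => /andP[/negPf fN /negPf fj].
    by rewrite /slide_step fN fj /= if_same.
  rewrite (@eq_filter _ _ (fun x => f x \notin [:: None; Some j])) => [|x].
    apply/eq_in_map => x; rewrite mem_filter => /andP[/sE + _].
    by rewrite /box_value => ->.
  case: (boolP (f x \in _)) => [fx|/[dup]/sE -> //].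
  rewrite /slide_step; case: ifP => _; first by rewrite fx.
  case: ifP => _; first by rewrite inE eqxx.
  by case: ifP => _; [rewrite !inE eqxx orbT | rewrite fx].
congr nat_of_bool; apply: eq_in_has => x; rewrite mem_diagonal => /andP[xD _].
rewrite /filled /slide_step xD /=.
case fj: (f x == Some j) => /=.
  case: ifP => [/adjacent_toP[y [yD xy fy]]|_]; last by rewrite (eqP fj) /= eqxx.
  apply/adjacent_toP; exists y; split=> //; rewrite yD fy /=.
  by rewrite ifT //; apply/adjacent_toP; exists x; rewrite neighborsC (eqP fj).
case fN: (f x == None) => /=; last by rewrite fj fN.
case: ifP => [|nadj]; first by rewrite eqxx.
(* A bullet without neighbor [j] acquires none: such a neighbor would have been a bullet, or a [j]
   already. *)
rewrite fj fN /=; apply/adjacent_toP => -[y [yD xy]]; rewrite yD /=.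
case: ifP => // _; case: ifP => [/andP[/eqP fy _] _|_ fy].
  exact: (nbul _ _ xD yD xy (eqP fN) fy).
by move/adjacent_toP: nadj; apply; exists y.
Qed.

Lemma bounding (D : {fset box}) : exists N, (forall x, x \in D -> x.1 < N) /\
  exists M, forall x, x \in D -> content N x < M.
Proof.
have bnd (g : box -> nat) : exists N, forall x, x \in D -> g x < N.
  exists (\max_(x <- enum_fset D) g x).+1 => x xD.
  by rewrite ltnS; apply: leq_bigmax_seq.
by have [N hN] := bnd fst; exists N; split=> //; apply: bnd.
Qed.

(** * Single swaps and sequences of swaps *)

Section Steps.

Variable D : {fset box}.
Hypothesis D_convex : convex D.

Lemma incr_neighbors i f : increasing_at D i f ->
  {in D &, forall x y, neighbors x y -> f x = None -> f y <> None}.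
Proof.
have [N [hN _]] := bounding D => fi x y xD yD xy fx fy.
by have := neighbors_key D_convex hN fi xD yD xy; rewrite fx fy eqxx.
Qed.

Lemma lt_not_neighbors (x y : box) : x \in D -> y \in D -> (x < y)%O ->
  ~~ neighbors x y -> exists z, [/\ z \in D, (x < z)%O & (z < y)%O].
Proof.
case: x y => [a b] [c d] xD yD; rewrite neighborsE box_ltE /= => xy nxy.
have [ac|ca] := ltnP a c.
  exists (a.+1, b); rewrite !box_ltE /=; split; try lia.
  by apply: (D_convex xD yD); rewrite box_leE /=; lia.
exists (a, b.+1); rewrite !box_ltE /=; split; try lia.
by apply: (D_convex xD yD); rewrite box_leE /=; lia.
Qed.

Lemma slide_stepP f j x : x \in D ->
  [\/ f x = Some j /\ (slide_step D f j x = None \/ slide_step D f j x = Some j),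
      f x = None /\ (slide_step D f j x = None \/ slide_step D f j x = Some j) |
      exists v, [/\ v != j, f x = Some v & slide_step D f j x = Some v]].
Proof.
move=> xD; rewrite /slide_step xD /=; case fx: (f x) => [v|] /=.
  rewrite (inj_eq Some_inj); have [->|vj] := eqVneq v j; last by constructor 3; exists v.
  by constructor 1; split=> //; case: ifP => _; [left | right].
by constructor 2; split=> //; case: ifP => _; [right | left].
Qed.

Lemma slide_swap f j x y : x \in D -> y \in D -> neighbors x y ->
  f x = None -> f y = Some j ->
  slide_step D f j x = Some j /\ slide_step D f j y = None.
Proof.
move=> xD yD xy fx fy; rewrite /slide_step xD yD fx fy !eqxx /=; split.
  by rewrite ifT //; apply/adjacent_toP; exists y.
by rewrite ifT //; apply/adjacent_toP; exists x; rewrite neighborsC.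
Qed.

(** The swap lifts the bullets past [i + 1]. A bullet below an [i + 1] in the order must be its
    neighbor, as no key fits between them, so the two really are exchanged. *)
Lemma slide_incr i f : increasing_at D i f ->
  increasing_at D (i + 1)%R (slide_step D f (i + 1)%R).
Proof.
move=> fi x y xD yD xy; have k := fi _ _ xD yD xy.
have nb : f x = None -> f y = Some (i + 1)%R -> neighbors x y.
  move=> fx fy; apply/negPn/negP => /(lt_not_neighbors xD yD xy) [z [zD xz zy]].
  have := fi _ _ xD zD xz; have := fi _ _ zD yD zy.
  by rewrite fx fy /=; case: (f z) => [v|] /=; lia.
case: (slide_stepP f (i + 1)%R xD) => [[fx gx]|[fx gx]|[v [vj fx gx]]];
  case: (slide_stepP f (i + 1)%R yD) => [[fy gy]|[fy gy]|[w [wj fy gy]]];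
  rewrite fx fy /= in k; try (by exfalso; lia).
- by case: gx => ->; rewrite gy /=; lia.
- by have [-> ->] := slide_swap xD yD (nb fx fy) fx fy; rewrite /=; lia.
- by case: gx => ->; rewrite gy /=; lia.
- by case: gy => ->; rewrite gx /=; lia.
- by case: gy => ->; rewrite gx /=; lia.
- by rewrite gx gy /=; lia.
Qed.

Lemma slide_incr_rev i f : increasing_at D (i + 1)%R f ->
  increasing_at D i (slide_step D f (i + 1)%R).
Proof.
move=> fi x y xD yD xy; have k := fi _ _ xD yD xy.
have nb : f x = Some (i + 1)%R -> f y = None -> neighbors x y.
  move=> fx fy; apply/negPn/negP => /(lt_not_neighbors xD yD xy) [z [zD xz zy]].
  have := fi _ _ xD zD xz; have := fi _ _ zD yD zy.
  by rewrite fx fy /=; case: (f z) => [v|] /=; lia.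
case: (slide_stepP f (i + 1)%R xD) => [[fx gx]|[fx gx]|[v [vj fx gx]]];
  case: (slide_stepP f (i + 1)%R yD) => [[fy gy]|[fy gy]|[w [wj fy gy]]];
  rewrite fx fy /= in k; try (by exfalso; lia).
- have yx : neighbors y x by rewrite neighborsC nb.
  by have [-> ->] := slide_swap yD xD yx fy fx; rewrite /=; lia.
- by case: gx => ->; rewrite gy /=; lia.
- by case: gx => ->; rewrite gy /=; lia.
- by case: gy => ->; rewrite gx /=; lia.
- by case: gy => ->; rewrite gx /=; lia.
- by rewrite gx gy /=; lia.
Qed.

Variables (N M : nat) (u : permZ).
Hypothesis D_rows : forall x, x \in D -> x.1 < N.
Hypothesis D_contents : forall x, x \in D -> content N x < M.

(** Raises the filled value and returns it to the end of its diagonals, ready for the next swap. *)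
Lemma act_last_word i f : increasing_at D i f ->
  act u (last_word D N f i M.+1) = act u (last_word D N f (i + 1)%R M.+1).
Proof.
move=> fi; rewrite (last_word_shift D_convex D_rows fi) //.
by apply: (first_word_last D_convex D_rows fi) => x /D_contents /ltnW.
Qed.

Definition slide_steps (f : box -> option int) (s : seq int) :=
  foldl (slide_step D) f s.

(** After [n] swaps the bullets lie just above [a + n - 1]. Each round first raises the filled value
    and then swaps, which preserves the filling. *)
Lemma act_slide_steps a n f : increasing_at D (a - 1)%R f ->
  let f' := slide_steps f [seq (a + k%:Z)%R | k <- iota 0 n] in
  increasing_at D (a + n%:Z - 1)%R f' /\
  act u (last_word D N f' (a + n%:Z - 1)%R M.+1) =
  act u (last_word D N f (a - 1)%R M.+1).
Proof.
move=> fi; elim: n => [|n [fi' IHn]]; first by rewrite /= addr0.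
rewrite -[in iota _ _]addn1 iotaD map_cat /slide_steps foldl_cat /= add0n.
rewrite /slide_steps in fi' IHn; move: (foldl _ _ _) fi' IHn => g gi gE.
have e : (a + n.+1%:Z - 1 = a + n%:Z)%R by lia.
have e' : (a + n%:Z = a + n%:Z - 1 + 1)%R by lia.
rewrite e -gE; split; first by rewrite e'; exact: slide_incr.
rewrite last_word_slide; last exact: incr_neighbors gi.
by rewrite (act_last_word gi) -e'.
Qed.

(** Here each round swaps first and lowers the filled value afterwards. *)
Lemma act_slide_steps_rev a n f : increasing_at D (a + n%:Z - 1)%R f ->
  let f' := slide_steps f (rev [seq (a + k%:Z)%R | k <- iota 0 n]) in
  increasing_at D (a - 1)%R f' /\
  act u (last_word D N f' (a - 1)%R M.+1) =
  act u (last_word D N f (a + n%:Z - 1)%R M.+1).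
Proof.
elim: n f => [|n IHn] f fi; first by move: fi; rewrite /= addr0.
rewrite -[in iota _ _]addn1 iotaD map_cat rev_cat /= add0n.
have e : (a + n.+1%:Z - 1 = a + n%:Z)%R by lia.
have e' : (a + n%:Z = a + n%:Z - 1 + 1)%R by lia.
rewrite e in fi *.
have gi : increasing_at D (a + n%:Z - 1)%R (slide_step D f (a + n%:Z)%R).
  by rewrite [X in slide_step _ _ X]e'; apply: slide_incr_rev; rewrite -e'.
have [hi ->] := IHn _ gi; split=> //.
rewrite (act_last_word gi) -e' last_word_slide //.
exact: incr_neighbors fi.
Qed.

End Steps.

Lemma bounded_slide_steps D a b f s : {in s, forall j, a <= j <= b}%R ->
  bounded D a b f -> bounded D a b (slide_steps D f s).
Proof.
elim: s f => //= j s IHs f sab fab; apply: IHs => [k ks|].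
  by apply: sab; rewrite inE ks orbT.
by apply: bounded_slide => //; apply: sab; rewrite mem_head.
Qed.

Lemma mem_int_range a b j : (j \in int_range a b) = (a <= j <= b)%R.
Proof.
rewrite /int_range; case: ifP => ab; last by rewrite in_nil; lia.
apply/mapP/idP => [[k]|jab]; first by rewrite mem_iota => kb ->; lia.
by exists `|j - a|%N; rewrite ?mem_iota; lia.
Qed.

Lemma content_word_slides D N M a b f u : convex D ->
    (forall x, x \in D -> x.1 < N) -> (forall x, x \in D -> content N x < M) ->
    (a <= b)%R -> bounded D a b f ->
  (increasing_at D (a - 1)%R f ->
     let f' := slide_steps D f (int_range a b) in
     increasing_at D b f' /\
  act u (content_word D N f' M.+1) = act u (content_word D N f M.+1)) /\
  (increasing_at D b f ->
     let f' := slide_steps D f (rev (int_range a b)) in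
     increasing_at D (a - 1)%R f' /\
  act u (content_word D N f' M.+1) = act u (content_word D N f M.+1)).
Proof.
move=> Dc DN DM ab fab; set s := int_range a b.
have sE : s = [seq (a + i%:Z)%R | i <- iota 0 `|b - a|%N.+1] by rewrite /s /int_range ab.
have bE : (a + `|b - a|%N.+1%:Z - 1 = b)%R by lia.
have gab t : t =i s -> bounded D a b (slide_steps D f t).
  by move=> ts; apply: bounded_slide_steps => // j; rewrite ts mem_int_range.
(* Filling with [b] may still be visible in the word, so the filled value is raised once more, to
   [b + 1], which no box holds. *)
have top g : increasing_at D b g -> bounded D a b g ->
    act u (last_word D N g b M.+1) = act u (content_word D N g M.+1).
  move=> gi gb; rewrite (act_last_word Dc u DN DM gi).
  by rewrite (last_word_content _ _ gb) //; lia.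
have bot g : bounded D a b g ->
    last_word D N g (a - 1)%R M.+1 = content_word D N g M.+1.
  by move=> gb; rewrite (last_word_content _ _ gb) //; lia.
split=> fi.
  have [] := act_slide_steps Dc u DN DM `|b - a|%N.+1 fi.
  by rewrite -sE bE bot // => gi <-; rewrite top //; apply: gab.
have := @act_slide_steps_rev D Dc N M u DN DM a `|b - a|%N.+1 f.
rewrite bE -sE => /(_ fi) [gi]; rewrite top // => <-; rewrite bot //.
by apply: gab => j; rewrite mem_rev.
Qed.

(** * Reading words of slides *)

(** Bullets and boxes outside the domain both give [None]; the domain is tracked separately and is
    unchanged by swaps. *)
Definition entry (Y : {fmap box -> option int}) (x : box) : option int :=
  odflt None Y.[? x]%fmap.

Lemma adjacent_entry (Y : {fmap box -> option int}) o (x : box) :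
  [exists y : domf Y, neighbors x (val y) && (Y y == o)] =
  adjacent_to (domf Y) (entry Y) o x.
Proof.
apply/existsP/adjacent_toP => [[y /andP[xy /eqP Yy]]|[y [yD xy Yy]]].
  by exists (val y); split; rewrite ?(valP y) // /entry -Some_fnd.
exists [` yD]%fset; rewrite xy /=; move: Yy; rewrite /entry in_fnd /= => ->.
by rewrite eqxx.
Qed.

Lemma entry_swap (Y : {fmap box -> option int}) j :
  entry (swap (Some j) None Y) = slide_step (domf Y) (entry Y) j.
Proof.
apply/funext => x; rewrite /slide_step.
have [xD|xD] /= := boolP (x \in domf Y); last by rewrite /entry !not_fnd.
rewrite {1}/entry in_fnd /= ffunE /= !adjacent_entry.
by have -> : Y [` xD]%fset = entry Y x by rewrite /entry in_fnd.
Qed.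

Lemma entry_swap_bullets (Y : {fmap box -> option int}) s :
  domf (swap_bullets Y s) = domf Y /\
  entry (swap_bullets Y s) = slide_steps (domf Y) (entry Y) s.
Proof.
rewrite /swap_bullets /slide_steps.
elim: s Y => //= j s IHs Y; have [-> ->] := IHs (swap (Some j) None Y).
by rewrite entry_swap.
Qed.

Lemma entry_del_bullets (Y : {fmap box -> option int}) x :
  (del_bullets Y).[? x]%fmap = entry Y x.
Proof. by rewrite /del_bullets fnd_reducef /entry; case: fnd. Qed.

Lemma entry_add_bullets (T : {fmap box -> int}) C x :
  entry (add_bullets T C) x = T.[? x]%fmap.
Proof.
rewrite /entry /add_bullets; have [xD|xD] := boolP (x \in domf T `|` C).
  by rewrite in_fnd /= ffunE.
rewrite not_fnd //= not_fnd //.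
by apply: contra xD => xT; rewrite in_fsetU xT.
Qed.

Lemma content_word_boxes D N f n : content_word D N f n =
  map (box_value f)
    (flatten [seq [seq x <- diagonal D N t | f x \notin [:: None]] | t <- iota 0 n]).
Proof. by rewrite map_flatten -map_comp. Qed.

Section ContentReading.

Variables (D : {fset box}) (N : nat) (f : box -> option int).
Local Notation boxes n :=
  (flatten [seq [seq x <- diagonal D N t | f x \notin [:: None]] | t <- iota 0 n]).

Lemma content_boxesS n :
  boxes n.+1 = boxes n ++ [seq x <- diagonal D N n | f x \notin [:: None]].
Proof. by rewrite -[in iota _ _]addn1 iotaD map_cat flatten_cat /= cats0. Qed.

Lemma mem_content_boxes n x :
  (x \in boxes n) = [&& x \in D, f x != None & content N x < n].
Proof.
elim: n => [|n IHn]; first by rewrite in_nil ltn0 !andbF.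
rewrite content_boxesS mem_cat IHn mem_filter mem_diagonal inE ltnS [in RHS]leq_eqVlt.
by case: (x \in D); case: (f x == None); case: (content N x == n);
  rewrite /= ?orbT ?orbF.
Qed.

Lemma content_boxes_uniq n : uniq (boxes n).
Proof.
elim: n => // n IHn; rewrite content_boxesS cat_uniq IHn /= !filter_uniq ?fset_uniq //.
rewrite andbT; apply/hasPn => x; rewrite mem_filter mem_diagonal => /and3P[_ _ /eqP xn].
by rewrite mem_content_boxes xn ltnn !andbF.
Qed.

Lemma content_boxes_index n x y : x \in boxes n -> y \in boxes n ->
  index x (boxes n) < index y (boxes n) -> content N x <= content N y.
Proof.
elim: n => // n IHn xn yn; rewrite content_boxesS !index_cat.
have [xb|xb] := boolP (x \in boxes n); have [yb|yb] := boolP (y \in boxes n).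
- exact: IHn.
- move=> _; move: xn yb yn; rewrite !mem_content_boxes => /and3P[_ _ xn] yb.
  by move=> /and3P[yD yN yn]; move: yb; rewrite yD yN /= -leqNgt; apply: leq_trans.
- move: yb; rewrite -index_mem; lia.
move: xn yb yn; rewrite !mem_content_boxes ltnS => /and3P[_ _ xn] yb /and3P[yD yN _].
by move=> _; move: yb; rewrite yD yN /= -leqNgt; apply: leq_trans.
Qed.

End ContentReading.

(** Reading by increasing content is compatible with the reading order. Two boxes can change order
    only if one is strictly southeast of the other, and then their entries commute by the gap
    hypothesis. *)
Lemma act_reading D N n f (T : {fmap box -> int}) a u :
    (forall x, x \in D -> x.1 < N) -> (forall x, x \in D -> content N x < n) ->
    (forall x, T.[? x]%fmap = if x \in D then f x else None) ->
    (forall x y v w, x \in D -> y \in D -> x.1 < y.1 -> x.2 < y.2 ->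
       f x = Some v -> f y = Some w -> far v w) ->
    reading_word T a ->
  act u a = act u (content_word D N f n).
Proof.
move=> DN Dn TE gap [s [us sT ord] sa].
have sP x : x \in s -> x \in D /\ exists v, f x = Some v.
  rewrite sT => xT; have := TE x; rewrite in_fnd; case: ifP => // xD <-.
  by split=> //; exists (T [` xT]%fset).
have -> : a = map (box_value f) s.
  apply: (inj_map Some_inj); rewrite -sa -map_comp; apply/eq_in_map => x /sP[xD [v fx]].
  by rewrite TE xD /= /box_value fx.
rewrite content_word_boxes; set s' := flatten _.
have s'E : s =i s'.
  move=> x; rewrite mem_content_boxes sT; apply/idP/and3P => [xT|[xD fx _]].
    have [xD [v fx]] : x \in D /\ exists v, f x = Some v by apply: sP; rewrite sT.
    by rewrite fx Dn.
  by rewrite -fndSome TE xD; case: (f x) fx.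
apply: act_trace => //.
  by apply: uniq_perm => //; apply: content_boxes_uniq.
move=> x y xs ys xy yx.
have [[xD [v fx]] [yD [w fy]]] := (sP _ xs, sP _ ys).
have cyx : content N y <= content N x.
  by apply: content_boxes_index yx; rewrite -s'E.
have nxy : x != y by apply: contraTneq xy => ->; rewrite ltnn.
(* If [x] were weakly northeast of [y], the reading order would put [y] first. *)
have o1 : ~ (x.1 <= y.1 /\ y.2 <= x.2).
  move=> [h1 h2]; have := ord y x ys xs; rewrite eq_sym => /(_ nxy h1 h2).
  by rewrite ltnNge ltnW.
(* If [x] were weakly southwest of [y], its content would be smaller. *)
have o2 : ~ (y.1 <= x.1 /\ x.2 <= y.2).
  have := DN _ xD; have := DN _ yD; move: cyx nxy; rewrite /content.
  case: (x) (y) => [b c] [d e]; rewrite -pair_eqE /=; lia.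
rewrite /box_value fx fy /=.
have [h1|h1] := ltnP x.1 y.1; have [h2|h2] := ltnP x.2 y.2.
- exact: gap xD yD h1 h2 fx fy.
- by case: o1; rewrite ltnW.
- by case: o2; rewrite (ltnW h2).
have [h3 h4] : y.1 < x.1 /\ y.2 < x.2.
  by split; rewrite ltnNge; apply/negP => h; [case: o1 | case: o2].
by have := gap _ _ _ _ yD xD h3 h4 fy fx; rewrite /far orbC.
Qed.

(** With the bullets below or above all values, the box between [x] and [y] holds an integer. *)
Lemma increasing_far D a b i f : convex D -> increasing_at D i f ->
    bounded D a b f -> (i < a)%R \/ (b <= i)%R ->
  forall x y v w, x \in D -> y \in D -> x.1 < y.1 -> x.2 < y.2 ->
    f x = Some v -> f y = Some w -> far v w.
Proof.
move=> Dc fi fab ib x y v w xD yD h1 h2 fx fy.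
have [N [DN _]] := bounding D.
have [z [_ [zD _ _ _ [+ _]]]] := key_between Dc DN fi xD yD h1 h2.
rewrite fx fy; have vab := fab _ _ xD fx; have wab := fab _ _ yD fy.
by rewrite /far; case: (f z) => [k|] /=; case: ib; lia.
Qed.

Lemma reading_words_slide D a b i i' f f' (T T' : {fmap box -> int}) u u' :
    convex D -> increasing_at D i f -> increasing_at D i' f' ->
    bounded D a b f -> bounded D a b f' ->
    (i < a)%R \/ (b <= i)%R -> (i' < a)%R \/ (b <= i')%R ->
    (forall x, T.[? x]%fmap = if x \in D then f x else None) ->
    (forall x, T'.[? x]%fmap = if x \in D then f' x else None) ->
    (forall N M, (forall x, x \in D -> x.1 < N) ->
       (forall x, x \in D -> content N x < M) ->
       act 1%g (content_word D N f' M.+1) = act 1%g (content_word D N f M.+1)) ->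
    reading_word T u -> reading_word T' u' ->
  hecke_word u' = hecke_word u.
Proof.
move=> Dc fi fi' fab fab' ii ii' TE TE' eqw uT uT'.
have [N [DN [M DM]]] := bounding D.
have DM1 x : x \in D -> content N x < M.+1 by move=> /DM /ltnW.
rewrite !hecke_wordE (act_reading _ DN DM1 TE (increasing_far Dc fi fab ii) uT).
by rewrite (act_reading _ DN DM1 TE' (increasing_far Dc fi' fab' ii') uT') eqw.
Qed.

Lemma straight_lt (nu : {fset box}) (x y : box) : straight_shape nu ->
  (x < y)%O -> y \in nu -> x \in nu.
Proof. by move=> nus /ltW; apply: nus. Qed.

Theorem corollary6p5 (lambda nu : {fset box}) (T T' : {fmap box -> int})
    (T_incr : increasing_tableau lambda nu T)
    (T_slide : forward_slide lambda T T' \/ reverse_slide nu T T')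
    (a a' : seq int) (a_T : reading_word T a) (a_T' : reading_word T' a') :
  hecke_word a' = hecke_word a.
Proof.
have [ls ns lns TD Tincr] := T_incr.
have TP x v : T.[? x]%fmap = Some v -> [/\ x \in nu, x \notin lambda &
    exists xT : x \in domf T, T [` xT]%fset = v].
  move=> e; have xT : x \in domf T by rewrite -fndSome e.
  move: (xT); rewrite {1}TD in_fsetD => /andP[xl xn]; split=> //; exists xT.
  by move: e; rewrite in_fnd => -[].
have Tlt x y v w : T.[? x]%fmap = Some v -> T.[? y]%fmap = Some w ->
    (x < y)%O -> (v < w)%R.
  move=> /TP[_ _ [xT <-]] /TP[_ _ [yT <-]] xy.
  exact: (Tincr [` xT]%fset [` yT]%fset xy).
have DE C x : x \in domf (add_bullets T C) = (x \in domf T) || (x \in C).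
  by rewrite in_fsetU.
have fD C x : x \in domf (add_bullets T C) -> T.[? x]%fmap = None -> x \in C.
  by rewrite DE => /orP[xT|//]; rewrite in_fnd.
have TE C x : T.[? x]%fmap =
    if x \in domf (add_bullets T C) then entry (add_bullets T C) x else None.
  by rewrite entry_add_bullets; case: ifPn => //; rewrite DE negb_or => /andP[/not_fnd].
have TE' C s x : (del_bullets (swap_bullets (add_bullets T C) s)).[? x]%fmap =
    if x \in domf (add_bullets T C)
    then slide_steps (domf (add_bullets T C)) (entry (add_bullets T C)) s x else None.
  have [dE <-] := entry_swap_bullets (add_bullets T C) s.
  rewrite entry_del_bullets; case: ifPn => // xD.
  by move: xD; rewrite -dE /entry => /not_fnd->.
have bnd p q C : values_in p q T ->
    bounded (domf (add_bullets T C)) p q (entry (add_bullets T C)).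
  move=> Tpq x v _; rewrite entry_add_bullets => /TP[_ _ [xT <-]].
  exact: (Tpq [` xT]%fset).
have domT x : (x \in domf T) = (x \in nu) && (x \notin lambda).
  by rewrite TD in_fsetD andbC.
have nfwd p q : ~~ (p <= q)%R -> int_range p q = [::] by rewrite /int_range => /negPf->.
case: T_slide => [[p [q [C [Tpq CP T'E]]]]|[p [q [C [Tpq CP T'E]]]]];
  have lo : (p - 1 < p)%R \/ (q <= p - 1)%R by [left; lia];
  have hi : (q < p)%R \/ (q <= q)%R by [right];
  move: (TE C) (TE' C) => {}TE {}TE';
  set D := domf (add_bullets T C) in TE TE' *;
  set f := entry (add_bullets T C) in TE TE' *;
  have fE x : f x = T.[? x]%fmap by exact: entry_add_bullets.
- have memD x : x \in D -> x \in nu /\ (x \in lambda -> maximal_box lambda x).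
    rewrite DE domT => /orP[/andP[-> /negPf->]|/CP xl] //.
    by split=> //; apply: (fsubsetP lns); case: xl.
  have Dc : convex D.
    move=> x y z xD yD; have [[xn xl] [yn _]] := (memD x xD, memD y yD).
    rewrite le_eqVlt => /orP[/eqP <- //|xz] zy.
    have zn := ns _ _ zy yn; rewrite DE domT zn /=.
    case zl: (z \in lambda) => //=.
    by have [_ /(_ z zl)] := xl (ls _ _ (ltW xz) zl).
  (* Bullets start in [lambda], where no entry precedes them, hence below all values. *)
  have fi : increasing_at D (p - 1)%R f.
    move=> x y xD yD xy; rewrite !fE.
    case xE: (T.[? x]%fmap) => [v|]; case yE: (T.[? y]%fmap) => [w|] /=.
    + by have := Tlt _ _ _ _ xE yE xy; lia.
    + have [yl _] := CP _ (fD _ _ yD yE); have [_ + _] := TP _ _ xE.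
      by rewrite (ls _ _ (ltW xy) yl).
    + by have := bnd _ _ C Tpq y w yD; rewrite -/f fE => /(_ yE); lia.
    + have [_ /(_ y)] := CP _ (fD _ _ xD xE).
      by have [yl _] := CP _ (fD _ _ yD yE); case/(_ yl).
  (* For an empty range no swap takes place, and deleting the bullets gives back [T]. *)
  have [pq|pq] := boolP (p <= q)%R; last first.
    have fpq := bnd _ _ C Tpq.
    apply: (reading_words_slide Dc fi fi fpq fpq lo lo TE) a_T a_T' => //.
    by move=> x; rewrite T'E /forward_jdt (nfwd _ _ pq) TE'.
  have [N [DN [M DM]]] := bounding D.
  have [fi' _] := (content_word_slides 1%g Dc DN DM pq (bnd _ _ C Tpq)).1 fi.
  apply: (reading_words_slide Dc fi fi' (bnd _ _ C Tpq) _ lo hi TE) a_T a_T'.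
  + by apply: bounded_slide_steps (bnd _ _ C Tpq) => j; rewrite mem_int_range.
  + by move=> x; rewrite T'E TE'.
  + move=> N' M' DN' DM'.
    by have [_ ->] := (content_word_slides 1%g Dc DN' DM' pq (bnd _ _ C Tpq)).1 fi.
- have memD x : x \in D -> x \notin lambda /\ (x \notin nu -> minimal_outer_box nu x).
    rewrite DE domT => /orP[/andP[-> ->]|/CP xn] //; split=> //.
    by apply: contra (xn.1); apply: (fsubsetP lns).
  have Dc : convex D.
    move=> x y z xD yD xz; have [[xl _] [_ yn]] := (memD x xD, memD y yD).
    rewrite le_eqVlt => /orP[/eqP -> //|zy].
    have zl : z \notin lambda by apply: contra xl; apply: ls xz.
    rewrite DE domT zl andbT; case zn: (z \in nu) => //=.
    have [/(straight_lt ns zy)|/yn [_ /(_ z)]] := boolP (y \in nu); first by rewrite zn.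
    by rewrite zn => /(_ isT).
  (* Bullets start outside [nu], where no entry follows them, hence above all values. *)
  have fi : increasing_at D q f.
    move=> x y xD yD xy; rewrite !fE.
    case xE: (T.[? x]%fmap) => [v|]; case yE: (T.[? y]%fmap) => [w|] /=.
    + by have := Tlt _ _ _ _ xE yE xy; lia.
    + by have := bnd _ _ C Tpq x v xD; rewrite -/f fE => /(_ xE); lia.
    + have [xn _] := CP _ (fD _ _ xD xE); have [yn _ _] := TP _ _ yE.
      by rewrite (straight_lt ns xy yn) in xn.
    + have [xn _] := CP _ (fD _ _ xD xE).
      by have [_ /(_ x xn)] := CP _ (fD _ _ yD yE).
  have [pq|pq] := boolP (p <= q)%R; last first.
    have fpq := bnd _ _ C Tpq.
    apply: (reading_words_slide Dc fi fi fpq fpq hi hi TE) a_T a_T' => //.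
    by move=> x; rewrite T'E /reverse_jdt (nfwd _ _ pq) TE'.
  have [N [DN [M DM]]] := bounding D.
  have [fi' _] := (content_word_slides 1%g Dc DN DM pq (bnd _ _ C Tpq)).2 fi.
  apply: (reading_words_slide Dc fi fi' (bnd _ _ C Tpq) _ hi lo TE) a_T a_T'.
  + by apply: bounded_slide_steps (bnd _ _ C Tpq) => j; rewrite mem_rev mem_int_range.
  + by move=> x; rewrite T'E TE'.
  + move=> N' M' DN' DM'.
    by have [_ ->] := (content_word_slides 1%g Dc DN' DM' pq (bnd _ _ C Tpq)).2 fi.
Qed.
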